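(* For every $t\in\Lambda^\circ$ there exists a polynomial $P$ such that for every $B\ge0$, $$\#\{x\in\mathcal T(F)\mid H(t,x)\le B\}\le P(B).$$
   Context: Let $F$ be a number field, $M_F^0$ and $M_F^\infty$ its sets of finite and infinite places. For $v\in M_F^0$ let $\operatorname{ord}_v$ be the normalized valuation of $F_v$ and $q_v$ the cardinality of its residue field; for $v\in M_F^\infty$ put $q_v:=e^{[F_v:\mathbb R]}$. A simplicial stacky fan $(\Sigma,N,\beta)$ consists of a finitely generated abelian group $N$ of rank $d$, a complete simplicial rational fan $\Sigma$ in $N_{\mathbb Q}$, and a homomorphism $\beta:\mathbb Z^{\Sigma(1)}\to N$ with finite cokernel such that for each ray $\rho\in\Sigma(1)$ the image of $\beta(e_\rho)$ in $N_{\mathbb Q}$ is a nonzero vector on $\rho$. Fix $N=N^{\mathrm{rig}}\oplus N_{\mathrm{tor}}$ with $N^{\mathrm{rig}}=\mathbb Z^d$ and $N_{\mathrm{tor}}\cong G^D:=\bigoplus_{i=1}^{\ell}\mathbb Z/n_i\mathbb Z$; let $G:=\prod_i\mu_{n_i}$, and let $b_\rho\in N^{\mathrm{rig}}$ be the $N^{\mathrm{rig}}$-component of $\beta(e_\rho)$. Let $\mathcal X$ be the associated (split) toric stack over $F$ and $\mathcal T=\mathbb G_m^d\times BG\subset\mathcal X$ its open stacky torus; for a field $K\supset F$, $\mathcal T(K)=(K^\times)^d\times\prod_i K^\times/(K^\times)^{n_i}$ (isomorphism classes of points). For $y\in N^{\mathrm{rig}}_{\mathbb R}$ choose a cone $\sigma\ni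 y$ and write uniquely $y=\sum_{\rho\in\sigma(1)}a_\rho(y)b_\rho$ with $a_\rho(y)\ge0$; set $a_\rho(y)=0$ for $\rho\notin\sigma(1)$ (independent of $\sigma$). For $n=(y,g)\in N$ put $a_\rho(n):=a_\rho(y)$ and $q(n):=(\sum_\rho\{a_\rho(y)\}b_\rho,\,g)$ ($\{\cdot\}$ = fractional part). Let $\mathrm{Box}(\Sigma):=q(N)$ and $\pi_0^*:=\mathrm{Box}(\Sigma)\setminus\{(0,0)\}$ (the twisted sectors of $\mathcal X$). Let $I:=\Sigma(1)\sqcup\pi_0^*$. Linear forms on $\mathbb R^I$: $\Xi_\rho(t)=t_\rho$ for $\rho\in\Sigma(1)$ and $\Xi_{\mathcal Y}(t)=t_{\mathcal Y}+\sum_{\rho\in\Sigma(1)}a_\rho(\mathcal Y)t_\rho$ for $\mathcal Y\in\pi_0^*$. Let $\Lambda:=\{t\in\mathbb R^I\mid\Xi_i(t)\ge0\ \forall i\in I\}$ and $\Lambda^\circ$ its interior (all $\Xi_i(t)>0$). For $s\in\mathbb C^I$ define $\varphi_s:N\to\mathbb C$ by $\varphi_s(n)=s_{q(n)}+\sum_\rho a_\rho(n)s_\rho$ if $q(n)\neq(0,0)$ and $\varphi_s(n)=\sum_\rho a_\rho(n)s_\rho$ otherwise, and let $\varphi_s^\infty:N^{\mathrm{rig}}_{\mathbb R}\to\mathbb C$ be the unique function that is linear on each cone of $\Sigma$ with $\varphi^\infty_s(b_\rho)=s_\rho$. For $v\in M_F^0$ let $\log_{\mathcal T,v}:\mathcal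 T(F_v)\to N$, $((t_j)_j,([u_i])_i)\mapsto((\operatorname{ord}_v t_j)_j,(\operatorname{ord}_v u_i\bmod n_i)_i)$; for $v\in M_F^\infty$ let $\log_{\mathcal T,v}:\mathcal T(F_v)\to\mathbb R^d$, $((t_j)_j,\ast)\mapsto(-\log|t_j|)_j$. Put $H_v(s,x):=q_v^{\varphi_s(\log_{\mathcal T,v}(x))}$ for $v\in M_F^0$, $H_v(s,x):=\exp([F_v:\mathbb R]\varphi^\infty_s(\log_{\mathcal T,v}(x)))$ for $v\in M_F^\infty$, and for $x\in\mathcal T(F)$, $H(s,x):=\prod_{v\in M_F}H_v(s,x)$. *)

(* Defs.v *)
From HB Require Import structures.
From mathcomp Require Import all_boot all_order all_algebra all_field.
From mathcomp Require Import all_classical all_reals sequences exp.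
From mathcomp Require Import complex.

Set Implicit Arguments.
Unset Strict Implicit.
Unset Printing Implicit Defensive.

Import Order.TTheory GRing.Theory Num.Theory.
Local Open Scope ring_scope.

(* The lattice N = Z^d (+) (+)_{i<l} Z/n_i Z.  An element is a pair     *)
(* (y, h) with y : Z^d and h : Z^l (torsion coordinates, read mod n_i). *)
(* Canonical representatives have 0 <= h_i < n_i (see [nred]).         *)
Definition Ntype (d l : nat) := ({ffun 'I_d -> int} * {ffun 'I_l -> int})%type.

Definition N0 (d l : nat) : Ntype d l := ([ffun => 0], [ffun => 0]).

Definition nred (d l : nat) (n : 'I_l -> nat) (x : Ntype d l) : Ntype d l :=
  (x.1, [ffun i => (x.2 i %% (n i)%:Z)%Z]).

(* Stacky fan data.  The rays of Sigma are indexed by 'I_r; b rho is the  *)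
(* N^rig-component of beta(e_rho) and g rho its torsion component.       *)
(* A cone of Sigma is given by its set of rays S : {set 'I_r}; the cone   *)
(* is cone(S) = sum_{rho in S} R_{>=0} b_rho  (simplicial cones).         *)

Definition cone_coord (R : realType) (d r : nat) (b : 'I_r -> 'I_d -> int)
  (S : {set 'I_r}) (y : 'I_d -> R) (a : 'I_r -> R) : Prop :=
  (forall rho, rho \notin S -> a rho = 0) /\ (forall rho, 0 <= a rho) /\
  (forall j, y j = \sum_(rho < r) a rho * (b rho j)%:~R).

Definition in_cone (R : realType) (d r : nat) (b : 'I_r -> 'I_d -> int)
  (S : {set 'I_r}) (y : 'I_d -> R) : Prop :=
  exists a : 'I_r -> R, cone_coord b S y a.

Definition complete_simplicial_fan (R : realType) (d r : nat) (Sigma : {set {set 'I_r}})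
  (b : 'I_r -> 'I_d -> int) : Prop :=
  (finset.set0 : {set 'I_r}) \in Sigma /\ (forall rho, [set rho]%SET \in Sigma) /\
  (forall S T : {set 'I_r}, S \in Sigma -> T \subset S -> T \in Sigma) /\
  (forall S, S \in Sigma -> forall c : 'I_r -> rat,
       (forall rho, rho \notin S -> c rho = 0) ->
       (forall j, \sum_(rho < r) c rho * (b rho j)%:~R = 0) ->
       forall rho, c rho = 0) /\
  (forall S S', S \in Sigma -> S' \in Sigma ->
     forall y : 'I_d -> R, in_cone b S y -> in_cone b S' y ->
       in_cone b (S :&: S') y) /\
  (forall y : 'I_d -> R, exists2 S, S \in Sigma & in_cone b S y).

(* beta : Z^{Sigma(1)} -> N, e_rho |-> (b rho, g rho), has finite cokernel:
   N is covered by finitely many cosets of the image of beta. *)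
Definition finite_coker (d l r : nat) (n : 'I_l -> nat)
  (b : 'I_r -> 'I_d -> int) (g : 'I_r -> 'I_l -> int) : Prop :=
  exists reps : seq (Ntype d l),
    forall x : Ntype d l, exists2 z, z \in reps &
      exists c : 'I_r -> int,
        (forall j, x.1 j = z.1 j + \sum_(rho < r) c rho * b rho j) /\
        (forall i, (x.2 i = z.2 i + \sum_(rho < r) c rho * g rho i %[mod (n i)%:Z])%Z).

(* a_rho(y) : the coordinates of y in (any) cone of Sigma containing y *)
Definition acoord (R : realType) (d r : nat) (Sigma : {set {set 'I_r}})
  (b : 'I_r -> 'I_d -> int) (y : 'I_d -> R) : 'I_r -> R :=
  xget (fun _ => 0)
    [set a : 'I_r -> R | exists2 S, S \in Sigma & cone_coord b S y a]%classic.

Definition realN (R : realType) (d l : nat) (x : Ntype d l) : 'I_d -> R :=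
  fun j => (x.1 j)%:~R.

(* q(n) = (sum_rho {a_rho(y)} b_rho, g), written as y - sum_rho floor(a_rho(y)) b_rho *)
Definition qmap (R : realType) (d l r : nat) (n : 'I_l -> nat)
  (Sigma : {set {set 'I_r}}) (b : 'I_r -> 'I_d -> int) (x : Ntype d l) : Ntype d l :=
  let a := acoord Sigma b (realN R x) in
  nred n ([ffun j => x.1 j - \sum_(rho < r) Num.floor (a rho) * b rho j], x.2).

Definition Box (R : realType) (d l r : nat) (n : 'I_l -> nat)
  (Sigma : {set {set 'I_r}}) (b : 'I_r -> 'I_d -> int) : set (Ntype d l) :=
  [set qmap R n Sigma b x | x in setT]%classic.

Definition twisted (R : realType) (d l r : nat) (n : 'I_l -> nat)
  (Sigma : {set {set 'I_r}}) (b : 'I_r -> 'I_d -> int) : set (Ntype d l) :=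
  (Box R n Sigma b `\` [set N0 d l])%classic.

(* An element t of R^I, I = Sigma(1) |_| pi_0^*, is given by
   tr : 'I_r -> R (the rays) and tY : Ntype d l -> R (only its values on
   twisted sectors are used).  Interior of Lambda: *)
Definition Lambda_interior (R : realType) (d l r : nat) (n : 'I_l -> nat)
  (Sigma : {set {set 'I_r}}) (b : 'I_r -> 'I_d -> int)
  (tr : 'I_r -> R) (tY : Ntype d l -> R) : Prop :=
  (forall rho, 0 < tr rho) /\
  (forall Y, twisted R n Sigma b Y ->
     0 < tY Y + \sum_(rho < r) acoord Sigma b (realN R Y) rho * tr rho).

Definition phiN (R : realType) (d l r : nat) (n : 'I_l -> nat)
  (Sigma : {set {set 'I_r}}) (b : 'I_r -> 'I_d -> int)
  (tr : 'I_r -> R) (tY : Ntype d l -> R) (x : Ntype d l) : R :=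
  (if qmap R n Sigma b x != N0 d l then tY (qmap R n Sigma b x) else 0) +
  \sum_(rho < r) acoord Sigma b (realN R x) rho * tr rho.

(* varphi_t^infty on N^rig_R: linear on each cone, b_rho |-> t_rho *)
Definition phiInf (R : realType) (d r : nat)
  (Sigma : {set {set 'I_r}}) (b : 'I_r -> 'I_d -> int)
  (tr : 'I_r -> R) (y : 'I_d -> R) : R :=
  \sum_(rho < r) acoord Sigma b y rho * tr rho.

(* finite places <-> normalized discrete valuations ord_v : F^x ->> Z
   (extended by ord_v 0 := 0 as a harmless convention) *)
Definition is_ord (F : fieldType) (w : F -> int) : Prop :=
  w 0 = 0 /\
  (forall x y, x != 0 -> y != 0 -> w (x * y) = w x + w y) /\
  (forall x y, x != 0 -> y != 0 -> x + y != 0 ->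
     Num.min (w x) (w y) <= w (x + y)) /\
  (exists x, x != 0 /\ w x = 1).

Definition fin_places (F : fieldType) : set (F -> int) := [set w | is_ord w]%classic.

Definition cong_m (F : fieldType) (w : F -> int) (x y : F) : Prop :=
  x = y \/ 0 < w (x - y).

Definition residue_card (F : fieldType) (w : F -> int) (q : nat) : Prop :=
  exists s : 'I_q -> F,
    (forall k, 0 <= w (s k)) /\
    (forall k k', cong_m w (s k) (s k') -> k = k') /\
    (forall x, 0 <= w x -> exists k, cong_m w x (s k)).

Definition qv (F : fieldType) (w : F -> int) : nat :=
  xget 0%N [set q | residue_card w q]%classic.

Definition is_emb (F : fieldType) (R : realType) (s : F -> R[i]) : Prop :=
  s 1 = 1 /\ (forall x y, s (x + y) = s x + s y) /\
  (forall x y, s (x * y) = s x * s y).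

(* infinite places = embeddings up to complex conjugation *)
Definition inf_places (F : fieldType) (R : realType) : set (F -> R[i]) -> Prop :=
  [set v | exists2 s, is_emb s & v = [set s; (fun x => conjc (s x))]]%classic.

(* [F_v : R] : 1 for a real place, 2 for a complex place *)
Definition locdeg (F : fieldType) (R : realType) (v : set (F -> R[i])) : R :=
  if `[< exists s, v = [set s]%classic >] then 1 else 2.

(* |x|_v, computed with any embedding representing v *)
Definition absv (F : fieldType) (R : realType) (v : set (F -> R[i])) (x : F) : R :=
  ComplexField.Normc.normc (xget (fun _ => 0) v x).

(* Points of the stacky torus T(F) = (F^x)^d x prod_i F^x/(F^x)^{n_i}  *)
Definition tpoint (F : fieldType) (d l : nat) := (('I_d -> F) * ('I_l -> F))%type.

Definition valid_point (F : fieldType) (d l : nat) (x : tpoint F d l) : Prop :=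
  (forall j, x.1 j != 0) /\ (forall i, x.2 i != 0).

Definition point_equiv (F : fieldType) (d l : nat) (n : 'I_l -> nat)
  (x x' : tpoint F d l) : Prop :=
  (forall j, x.1 j = x'.1 j) /\
  (forall i, exists c : F, c != 0 /\ x'.2 i = x.2 i * c ^+ n i).

Definition log_fin (F : fieldType) (d l : nat) (n : 'I_l -> nat)
  (w : F -> int) (x : tpoint F d l) : Ntype d l :=
  nred n ([ffun j => w (x.1 j)], [ffun i => w (x.2 i)]).

Definition log_inf (F : fieldType) (R : realType) (d l : nat)
  (v : set (F -> R[i])) (x : tpoint F d l) : 'I_d -> R :=
  fun j => - ln (absv v (x.1 j)).

Definition height (F : fieldType) (R : realType) (d l r : nat) (n : 'I_l -> nat)
  (Sigma : {set {set 'I_r}}) (b : 'I_r -> 'I_d -> int)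
  (tr : 'I_r -> R) (tY : Ntype d l -> R) (x : tpoint F d l) : R :=
  (\big[*%R/1]_(w \in @fin_places F)
      ((qv w)%:R `^ phiN n Sigma b tr tY (log_fin n w x))) *
  (\big[*%R/1]_(v \in @inf_places F R)
      expR (locdeg v * phiInf Sigma b tr (log_inf v x))).

(* Main.v *)
Require Import Defs.
From HB Require Import structures.
From mathcomp Require Import all_boot all_order all_algebra all_field.
From mathcomp Require Import all_classical all_reals sequences exp.
From mathcomp Require Import complex.
From mathcomp Require Import zify ring lra.

(** The functions phi_t and phi_t^infty dominate a positive multiple of |y|, and
    phi_t is bounded below by a positive constant away from 0.  Hence H(t,x) <= B
    bounds by a power of B the product of the q_w^|w(t_j)|, every |sigma(t_j)|, and
    the product of the q_w over the places with n_i not dividing w(u_i).  So t_j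
    has a denominator m and a numerator m t_j of polynomially bounded size, and
    Minkowski's argument, in the form of a pigeonhole principle, changes u_i by an
    n_i-th power into an algebraic integer whose conjugates are all polynomially
    bounded.  The same pigeonhole principle shows that there are at most (11 X)^D
    algebraic integers with conjugates bounded by X, because a nonzero algebraic
    integer has norm at least 1.

    That an element with w(x) >= 0 for all w is an algebraic integer is the
    existence of valuations: if y is not integral, a maximal subring containing
    1/y but not y is a discrete valuation ring. *)

(** Places are arbitrary functions satisfying [is_ord], and two conventions intervene: [qv] is 0
    when no residue cardinality exists, and a product over all places is 1 when its support is
    infinite. A bound on [height] therefore says something about a point only after residue fields
    and supports have been shown finite. Both facts come from one packing inequality, [index_bound],
    which bounds the number of residues modulo z by the product of the |sigma z|; it works with
    independent integral elements instead of a basis of O, at the price of a constant. Such losses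
    are harmless, since the theorem asks only for some polynomial. All local factors of H are at
    least 1, so every finite subproduct is at most B. The count itself is an injection into a finite
    set of codes: a rigid coordinate t_j is recovered from m and m t_j, a torsion coordinate from an
    integral representative of its class. *)

Set Implicit Arguments.
Unset Strict Implicit.
Unset Printing Implicit Defensive.

Import Order.TTheory GRing.Theory Num.Theory.
Local Open Scope ring_scope.

(** * Discrete valuations *)

(* [is_ord] sets w 0 = 0; [vge] restores the convention w 0 = +oo. *)
Definition vge (F : fieldType) (w : F -> int) (m : int) (x : F) : bool :=
  (x == 0) || (m <= w x).

(* The ring of integers of F: see [inO_integral]. *)
Definition inO (F : fieldType) (x : F) : Prop :=
  forall w : F -> int, is_ord w -> vge w 0 x.

Section Valuations.
Variables (F : fieldType) (w : F -> int).
Hypothesis hw : is_ord w.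

Lemma ord_zero : w 0 = 0. Proof. by case: hw. Qed.

Lemma ordM x y : x != 0 -> y != 0 -> w (x * y) = w x + w y.
Proof. by case: hw => _ [+ _]; exact. Qed.

Lemma ord_one : w 1 = 0.
Proof.
have := ordM (oner_neq0 F) (oner_neq0 F); rewrite mulr1 => e.
by apply: (addrI (w 1)); rewrite addr0 -e.
Qed.

Lemma ordX x n : x != 0 -> w (x ^+ n) = w x * n%:Z.
Proof.
move=> x0; elim: n => [|n IH]; first by rewrite expr0 ord_one mulr0.
by rewrite exprS ordM ?expf_neq0 // IH; lia.
Qed.

Lemma ordV x : x != 0 -> w x^-1 = - w x.
Proof.
move=> x0; have : w (x * x^-1) = w x + w x^-1 by rewrite ordM ?invr_neq0.
by rewrite divff // ord_one; lia.
Qed.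

Lemma ord_div x y : x != 0 -> y != 0 -> w (x / y) = w x - w y.
Proof. by move=> x0 y0; rewrite ordM ?invr_neq0// ordV. Qed.

Lemma ordN x : w (- x) = w x.
Proof.
have [->|x0] := eqVneq x 0; first by rewrite oppr0.
have n10 : (-1 : F) != 0 by rewrite oppr_eq0 oner_neq0.
have : w ((-1) * (-1)) = w (-1) + w (-1) by rewrite ordM.
rewrite mulrNN mulr1 ord_one => e; rewrite -mulN1r ordM //; lia.
Qed.

Lemma vge0 m : vge w m 0. Proof. by rewrite /vge eqxx. Qed.

Lemma vgeE m x : x != 0 -> vge w m x = (m <= w x).
Proof. by rewrite /vge => /negPf ->. Qed.

Lemma vgeW m m' x : m <= m' -> vge w m' x -> vge w m x.
Proof. by rewrite /vge => mm /orP[->//|/(le_trans mm) ->]; rewrite orbT. Qed.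

Lemma vgeN m x : vge w m (- x) = vge w m x.
Proof. by rewrite /vge oppr_eq0 ordN. Qed.

Lemma vgeD m x y : vge w m x -> vge w m y -> vge w m (x + y).
Proof.
have [->|x0] := eqVneq x 0; first by rewrite add0r.
have [->|y0] := eqVneq y 0; first by rewrite addr0.
have [->|xy0] := eqVneq (x + y) 0; first by rewrite vge0.
rewrite !vgeE // => mx my; case: hw => _ [_ [h _]].
have := h _ _ x0 y0 xy0; by apply: le_trans; rewrite le_min mx.
Qed.

Lemma vgeB m x y : vge w m x -> vge w m y -> vge w m (x - y).
Proof. by move=> hx hy; rewrite vgeD // vgeN. Qed.

Lemma vgeM m m' x y : vge w m x -> vge w m' y -> vge w (m + m') (x * y).
Proof.
have [->|x0] := eqVneq x 0; first by rewrite mul0r => _ _; exact: vge0.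
have [->|y0] := eqVneq y 0; first by rewrite mulr0 => _ _; exact: vge0.
by rewrite !vgeE ?mulf_neq0 // ordM // => ? ?; apply: lerD.
Qed.

Lemma vgeM0 m x y : vge w m x -> vge w 0 y -> vge w m (x * y).
Proof. by move=> h1 h2; rewrite -[m]addr0 vgeM. Qed.

Lemma vge_unitM m x y : x != 0 -> w x = 0 -> vge w m (x * y) = vge w m y.
Proof.
move=> x0 wx; have [->|y0] := eqVneq y 0; first by rewrite mulr0 !vge0.
by rewrite !vgeE ?mulf_neq0 // ordM // wx add0r.
Qed.

Lemma vge_sum m (I : Type) (r : seq I) (P : pred I) (f : I -> F) :
  (forall i, P i -> vge w m (f i)) -> vge w m (\sum_(i <- r | P i) f i).
Proof.
move=> h; elim/big_rec: _ => [|i x Pi hx]; first exact: vge0.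
by rewrite vgeD ?h.
Qed.

Lemma vge1 : vge w 0 1. Proof. by rewrite vgeE ?oner_neq0 // ord_one. Qed.

Lemma vgeX x n : vge w 0 x -> vge w 0 (x ^+ n).
Proof.
move=> h; elim: n => [|n IH]; first by rewrite expr0 vge1.
by rewrite exprS vgeM0.
Qed.

Lemma vge_nat n : vge w 0 n%:R.
Proof. by elim: n => [|n IH]; rewrite ?vge0 // -natr1 vgeD ?vge1. Qed.

Lemma vge_int (k : int) : vge w 0 k%:~R.
Proof. by case: k => n; rewrite ?NegzE ?mulrNz ?vgeN vge_nat. Qed.

Lemma vge_prod (I : Type) (r : seq I) (P : pred I) (f : I -> F) :
  (forall i, P i -> vge w 0 (f i)) -> vge w 0 (\prod_(i <- r | P i) f i).
Proof.
by move=> h; elim/big_rec: _ => [|i x Pi hx]; [apply: vge1 | rewrite vgeM0 ?h].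
Qed.

Lemma ord_prod (I : Type) (r : seq I) (P : pred I) (f : I -> F) :
  (forall i, P i -> f i != 0) ->
  w (\prod_(i <- r | P i) f i) = \sum_(i <- r | P i) w (f i).
Proof.
move=> h; have [//] : w (\prod_(i <- r | P i) f i) = \sum_(i <- r | P i) w (f i)
  /\ \prod_(i <- r | P i) f i != 0.
elim/big_rec2: _ => [|i x y Pi [<- hy]]; first by rewrite ord_one oner_neq0.
by rewrite ordM ?h // mulf_neq0 ?h.
Qed.

End Valuations.

Section Ring.
Variable F : fieldType.
Implicit Types x y : F.

Lemma inO0 : inO (0 : F). Proof. by move=> w hw; exact: vge0. Qed.
Lemma inO1 : inO (1 : F). Proof. by move=> w hw; exact: vge1. Qed.
Lemma inOD x y : inO x -> inO y -> inO (x + y).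
Proof. by move=> hx hy w hw; rewrite vgeD ?hx ?hy. Qed.
Lemma inON x : inO x -> inO (- x).
Proof. by move=> hx w hw; rewrite vgeN ?hx. Qed.
Lemma inOB x y : inO x -> inO y -> inO (x - y).
Proof. by move=> hx hy; apply/inOD/inON. Qed.
Lemma inOM x y : inO x -> inO y -> inO (x * y).
Proof. by move=> hx hy w hw; rewrite vgeM0 ?hx ?hy. Qed.
Lemma inOX x n : inO x -> inO (x ^+ n).
Proof. by move=> hx w hw; rewrite vgeX ?hx. Qed.
Lemma inO_int (k : int) : inO (k%:~R : F).
Proof. by move=> w hw; exact: vge_int. Qed.
Lemma inO_nat n : inO (n%:R : F).
Proof. by move=> w hw; exact: vge_nat. Qed.
Lemma inO_sum (I : Type) (r : seq I) (P : pred I) (f : I -> F) :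
  (forall i, P i -> inO (f i)) -> inO (\sum_(i <- r | P i) f i).
Proof. by move=> h w hw; apply: vge_sum => // i /h; exact. Qed.
Lemma inO_prod (I : Type) (r : seq I) (P : pred I) (f : I -> F) :
  (forall i, P i -> inO (f i)) -> inO (\prod_(i <- r | P i) f i).
Proof. by move=> h w hw; apply: vge_prod => // i /h; exact. Qed.

End Ring.

(** * Integral polynomials and denominators *)

Section IntegerPolynomials.
Variable F : fieldExtType rat.
Implicit Types x y : F.

Lemma intF_eq0 (k : int) : (k%:~R == 0 :> F) = (k == 0).
Proof.
rewrite -[k%:~R](rmorph_int (GRing.in_alg F)) fmorph_eq0.
by rewrite -(mulr0z (1 : rat)) eqr_int.
Qed.

Lemma natF_eq0 (n : nat) : (n%:R == 0 :> F) = (n == 0%N).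
Proof. exact: (intF_eq0 n%:Z). Qed.

(** A primitive integral multiple of the minimal polynomial. Content 1 means that at each place some
    coefficient is a unit; the degree bound, uniform in x, later makes value groups discrete. *)
Lemma primitive_int_root x :
  exists p : {poly int}, [/\ zcontents p = 1,
    (size p <= (\dim {:F}).+1)%N & (map_poly intr p).[x] = 0].
Proof.
have /polyOver1P[q eq_q] := minPolyOver 1%AS x.
have q0 : q != 0.
  apply/eqP => q0; have /monic_neq0 := monic_minPoly 1%AS x.
  by rewrite eq_q q0 map_poly0 eqxx.
have [p [a a0 eq_p]] := rat_poly_scale q.
have p0 : p != 0 by apply: contraNneq q0 => p0; rewrite eq_p p0 map_poly0 scaler0.
exists (zprimitive p); split; first by rewrite zcontents_primitive p0.
  rewrite size_zprimitive.
  have -> : size p = size (minPoly 1%AS x).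
    rewrite eq_q size_map_poly eq_p size_scale ?invr_eq0 ?intr_eq0 //.
    by rewrite size_map_poly_id0 // intr_eq0 lead_coef_eq0.
  by rewrite size_minPoly ltnS adjoin_degreeE dimv1 divn1 dimvS ?subvf.
have c0 : (zcontents p)%:~R != 0 :> F by rewrite intF_eq0 zcontents_eq0.
apply: (mulfI c0); rewrite mulr0 -hornerZ -map_polyZ -zpolyEprim.
have a0F : a%:~R != 0 :> F by rewrite intF_eq0.
have eqF : map_poly (intr : int -> F) p = a%:~R *: minPoly 1%AS x.
  have -> : map_poly intr p = map_poly (GRing.in_alg F) (map_poly intr p).
    rewrite -map_poly_comp; apply: eq_map_poly => k.
    exact/esym/(rmorph_int (GRing.in_alg F)).
  have -> : map_poly intr p = a%:~R *: q.
    by rewrite eq_p scalerA divff ?scale1r // intr_eq0.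
  by rewrite map_polyZ eq_q (rmorph_int (GRing.in_alg F)).
rewrite eqF hornerZ; have /rootP -> := root_minPoly 1%AS x.
by rewrite mulr0.
Qed.

(* If p x = 0 then both htail k and x * htail k.+1 are integral: where w x >= 0
   they are polynomials in x, and where w x < 0 they are, up to sign,
   polynomials in x^-1. *)
Section Tails.
Variables (p : {poly int}) (x : F).

Definition htail k : F := (map_poly intr (drop_poly k p)).[x].

Lemma htailS k : htail k = (p`_k)%:~R + x * htail k.+1.
Proof.
have e : drop_poly k p = (p`_k)%:P + 'X * drop_poly k.+1 p.
  apply/polyP => -[|i]; rewrite coef_drop_poly coefD coefC coefXM /= ?addr0 //.
  by rewrite coef_drop_poly add0r addSnnS.
by rewrite /htail {1}e rmorphD rmorphM /= map_polyC map_polyX !hornerE.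
Qed.

Lemma htail_big k : (size p <= k)%N -> htail k = 0.
Proof. by move=> hk; rewrite /htail drop_poly_eq0 // map_poly0 horner0. Qed.

Hypothesis px0 : (map_poly intr p).[x] = 0.

Lemma htail0 : htail 0 = 0. Proof. by rewrite /htail drop_poly0l. Qed.

Lemma inO_htail k : inO (htail k).
Proof.
move=> w hw; have [hx|hx] := boolP (vge w 0 x).
  rewrite /htail horner_coef; apply: vge_sum => // i _.
  by rewrite coef_map /= vgeM0 ?vge_int ?vgeX.
have x0 : x != 0 by apply: contraNneq hx => ->; exact: vge0.
have hV : vge w 0 x^-1.
  by rewrite vgeE ?invr_neq0 // ordV //; move: hx; rewrite vgeE //; lia.
elim: k => [|k IH]; first by rewrite htail0 vge0.
suff -> : htail k.+1 = (htail k - (p`_k)%:~R) * x^-1.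
  by rewrite vgeM0 ?vgeB ?vge_int.
by rewrite (htailS k) [_ + x * _]addrC addrK mulrC mulKf.
Qed.

Lemma inO_mul_htail k : inO (x * htail k.+1).
Proof.
suff -> : x * htail k.+1 = htail k - (p`_k)%:~R.
  by apply/inOB/inO_int/inO_htail.
by rewrite (htailS k) [_ + x * _]addrC addrK.
Qed.

End Tails.

(** Let w t = 1 and p t = 0 with p primitive. If 0 were the only integer in the maximal ideal, then
    p_0 = - t * htail 1 would vanish, hence also htail 1, and inductively all of p. The least
    positive integer m in the ideal divides the others by division with remainder. *)
Lemma int_in_ideal (w : F -> int) : is_ord w ->
  exists m : nat, [/\ (1 < m)%N, vge w 1 m%:R &
    forall k : int, vge w 1 k%:~R -> (m %| k)%Z].
Proof.
move=> hw.
have [k k0 hk] : exists2 k : int, k != 0 & vge w 1 k%:~R.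
  have [t [t0 wt]] : exists t, t != 0 /\ w t = 1 by case: hw => _ [_ [_]].
  have [p [cp _ pt]] := primitive_int_root t.
  apply: contrapT => h.
  have hz k : vge w 1 (k%:~R) -> k = 0.
    by move=> hk; apply/eqP/negPn/negP => k0; apply: h; exists k.
  have htl : forall k, htail p t k = 0.
    elim=> [|k IH]; first exact: htail0.
    have := htailS p t k; rewrite IH => /esym /eqP; rewrite addr_eq0 => /eqP e.
    have a0 : p`_k = 0.
      apply: hz; rewrite e vgeN // -[1]addr0; apply: vgeM => //.
        by rewrite vgeE // wt.
      by apply: inO_htail.
    move: e; rewrite a0 mulr0z => /esym/eqP.
    by rewrite oppr_eq0 mulf_eq0 (negPf t0) => /eqP.
  suff p0 : p = 0 by move: cp; rewrite p0 zcontents0.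
  apply/polyP => k; rewrite coef0; apply/eqP; rewrite -intF_eq0.
  by have := htailS p t k; rewrite !htl mulr0 addr0 => /esym ->.
have ex : exists m : nat, (0 < m)%N && vge w 1 m%:R.
  exists `|k|%N; rewrite absz_gt0 k0 /=.
  by case: k hk {k0} => // n; rewrite NegzE mulrNz vgeN.
case: (ex_minnP ex) => m /andP[m0 hm] mmin; exists m; split=> //.
  rewrite ltn_neqAle m0 andbT; apply/eqP => m1.
  by move: hm; rewrite -m1 vgeE ?oner_neq0 // ord_one.
move=> j hj; have e := divz_eq j m.
have hr : vge w 1 ((j %% m)%Z)%:~R.
  have -> : ((j %% m)%Z)%:~R = j%:~R - m%:R * ((j %/ m)%Z)%:~R :> F.
    have := congr1 (intr : int -> F) e.
    by rewrite intrD intrM => ->; rewrite mulrC addrC addKr.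
  by rewrite vgeB // vgeM0 ?vge_int.
have r0 : 0 <= (j %% m)%Z by rewrite modz_ge0 //; lia.
have rm : (j %% m)%Z < m by rewrite ltz_pmod.
case er : (j %% m)%Z r0 rm hr => [r|//] _ rm hr.
case: r er rm hr => [|r] er rm hr; first by apply/dvdz_mod0P.
by have := mmin r.+1; rewrite hr => /(_ isT); lia.
Qed.

(** The valuation ring of w is the localization of O at w. Some tail of p is a unit at w, since
    otherwise every coefficient p_i = htail i - x * htail (i+1) would lie in the maximal ideal,
    against content 1; that tail is a denominator of x. *)
Lemma denominator (w : F -> int) x : is_ord w -> vge w 0 x ->
  exists s : F, [/\ inO s, inO (s * x), s != 0 & w s = 0].
Proof.
move=> hw wx.
have [p [cp _ px]] := primitive_int_root x.
have [m [m1 _ hm]] := int_in_ideal hw.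
have [k hk] : exists k, ~~ vge w 1 (htail p x k.+1).
  apply: contrapT => h.
  have hh k : vge w 1 (htail p x k).
    case: k => [|k]; first by rewrite htail0 // vge0.
    by apply/negPn/negP => hk; apply: h; exists k.
  have : (m %| zcontents p)%Z.
    rewrite dvdz_contents; apply/polyOverP => i; apply: hm.
    have /eqP := htailS p x i; rewrite -subr_eq => /eqP <-.
    by rewrite vgeB // mulrC vgeM0.
  by rewrite cp dvdz1 /=; lia.
exists (htail p x k.+1); have s0 : htail p x k.+1 != 0.
  by apply: contraNneq hk => ->; exact: vge0.
split=> //; first exact: inO_htail.
  by rewrite mulrC; exact: inO_mul_htail.
have := inO_htail px k.+1 hw; move: hk; rewrite !vgeE //; lia.
Qed.

End IntegerPolynomials.

(** * Existence of valuations at non-integral elements *)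

(** The value group is generated by its least positive element c, and w is v divided by c. *)
Lemma normalize_ord (F : fieldType) (v : F -> int) : v 0 = 0 ->
  (forall x y, x != 0 -> y != 0 -> v (x * y) = v x + v y) ->
  (forall x y, x != 0 -> y != 0 -> x + y != 0 ->
     Num.min (v x) (v y) <= v (x + y)) ->
  (exists2 x, x != 0 & v x != 0) ->
  exists2 w, is_ord w & exists2 c : int, 0 < c & forall x, v x = w x * c.
Proof.
move=> v0 vM vD [x x0 vx].
have v1 : v 1 = 0.
  have := vM 1 1 (oner_neq0 F) (oner_neq0 F); rewrite mulr1 => e.
  by apply: (addrI (v 1)); rewrite addr0 -e.
have vV z : z != 0 -> v z^-1 = - v z.
  move=> z0; have : v (z * z^-1) = v z + v z^-1 by rewrite vM ?invr_neq0.
  by rewrite divff // v1; lia.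
have vX z n : z != 0 -> v (z ^+ n) = v z * n%:Z.
  move=> z0; elim: n => [|n IH]; first by rewrite expr0 v1 mulr0.
  by rewrite exprS vM ?expf_neq0 // IH; lia.
have vXz z (k : int) : z != 0 -> v (z ^ k) = v z * k.
  move=> z0; case: k => n; first by rewrite -exprnP vX.
  by rewrite NegzE -exprnN vV ?expf_neq0 // vX //; lia.
have ex : exists n : nat, (0 < n)%N && `[< exists2 z, z != 0 & v z = n >].
  exists `|v x|%N; rewrite absz_gt0 vx; apply/asboolP.
  case: (lerP 0 (v x)) => h; first by exists x => //; lia.
  by exists x^-1; rewrite ?invr_neq0 // vV //; lia.
case: (ex_minnP ex) => c /andP[c0 /asboolP[z z0 vz]] cmin.
have cdvd y : y != 0 -> (c %| v y)%Z.
  move=> y0; have e := divz_eq (v y) c.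
  have yz0 : y * z ^ (- (v y %/ c)%Z) != 0 by rewrite mulf_neq0 ?expfz_neq0.
  have hr : v (y * z ^ (- (v y %/ c)%Z)) = (v y %% c)%Z.
    by rewrite vM ?expfz_neq0 // vXz // vz; lia.
  have r0 : 0 <= (v y %% c)%Z by rewrite modz_ge0 //; lia.
  have rm : (v y %% c)%Z < c by rewrite ltz_pmod.
  apply/dvdz_mod0P; case er : (v y %% c)%Z r0 rm hr => [r|//] _ rm hr.
  case: r er rm hr => [//|r] er rm hr; have := cmin r.+1.
  have -> : `[< exists2 z, z != 0 & v z = r.+1 >].
    by apply/asboolP; exists (y * z ^ (- (v y %/ c)%Z)).
  by move=> /(_ isT); lia.
have vw y : v y = (v y %/ c)%Z * c.
  have [->|y0] := eqVneq y 0; first by rewrite v0 div0z.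
  by rewrite divzK // cdvd.
exists (fun y => (v y %/ c)%Z); last by exists c.
split; first by rewrite v0 div0z.
have cne : (c : int) != 0 by lia.
split=> [a b a0 b0|]; first by rewrite vM // divzDl // cdvd.
split=> [a b a0 b0 ab0|]; last by exists z; split=> //; rewrite vz divzz; lia.
have := vD _ _ a0 b0 ab0; rewrite !ge_min => /orP[] h; apply/orP; [left|right];
  by rewrite lez_divRL // (le_trans (lez_floor _ cne)).
Qed.

(** * Maximal subrings that contain 1/y but not y *)

Section ValuationRing.
Variable F : fieldExtType rat.
Variable y : F.
Hypothesis hy : ~ integralOver (intr : int -> F) y.

Let t := y^-1.

Let y0 : y != 0.
Proof. by apply/eqP => e; apply: hy; rewrite e; exact: integral0. Qed.

Definition avoiding (A : set F) : Prop :=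
  [/\ A 1, (forall a b, A a -> A b -> A (a - b)),
    (forall a b, A a -> A b -> A (a * b)), A y^-1 & ~ A y].

(* If y = p(1/y), clearing denominators makes y a root of a monic polynomial. *)
Lemma avoiding_base :
  avoiding [set x | exists p : {poly int}, x = (map_poly intr p).[t]].
Proof.
split.
- by exists 1; rewrite rmorph1 hornerC.
- by move=> a b [p ->] [q ->]; exists (p - q); rewrite rmorphB /= !hornerE.
- by move=> a b [p ->] [q ->]; exists (p * q); rewrite rmorphM /= !hornerE.
- by exists 'X; rewrite map_polyX hornerX.
move=> [p e]; apply: hy.
pose m := size p.
pose q : {poly int} := 'X^m - \sum_(i < m) p`_i *: 'X^(m.-1 - i).
exists q.
  rewrite /q monicE lead_coefDl ?lead_coefXn // size_polyXn size_polyN.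
  rewrite ltnS; apply/leq_sizeP => j hj; rewrite coef_sum big1 // => i _.
  rewrite coefZ coefXn; case: eqP => [e'|_]; rewrite ?mulr0 //.
  by move: (ltn_ord i) hj; rewrite e'; lia.
have m0 : (0 < m)%N.
  rewrite lt0n /m size_poly_eq0; apply/eqP => p0; move: e.
  by rewrite p0 map_poly0 horner0 => /eqP; rewrite (negPf y0).
apply/rootP; rewrite rmorphB /= rmorph_sum /= map_polyXn hornerD hornerN hornerXn.
rewrite horner_sum; apply/eqP; rewrite subr_eq0; apply/eqP.
rewrite -{1}(prednK m0) exprS {1}e horner_coef size_map_poly_id0; last first.
  by rewrite intF_eq0 lead_coef_eq0 -size_poly_gt0.
rewrite mulr_suml; apply: eq_bigr => i _.
rewrite map_polyZ map_polyXn hornerZ hornerXn coef_map /= -mulrA; congr (_ * _).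
have im : (i + (m.-1 - i))%N = m.-1 by move: (ltn_ord i); rewrite -/m; lia.
rewrite -{1}im.
by rewrite exprD mulrA /t -exprMn mulVf // expr1n mul1r; congr (_ ^+ _); lia.
Qed.

Lemma maximal_avoiding : exists2 A, avoiding A &
  forall B, avoiding B -> (A `<=` B)%classic -> (B `<=` A)%classic.
Proof.
(* The union of the empty chain is empty, hence the alternative [A = set0]; [avoiding_base] then
   shows that a maximal A is not empty. *)
have [|A [[A0|hA] Amax]] := @Zorn_bigcup F (fun A => A = set0 \/ avoiding A).
- move=> G GP Gtot.
  have [[X GX X0]|h] := pselect (exists2 X, G X & X <> set0); last first.
    left; apply/seteqP; split=> // x [X GX Xx]; apply: h; exists X => // X0.
    by move: Xx; rewrite X0.
  have good Z x : G Z -> Z x -> avoiding Z.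
    by move=> GZ Zx; case: (GP _ GZ) => // Z0; move: Zx; rewrite Z0.
  have [X1 XB XM Xt Xy] : avoiding X by case: (GP _ GX).
  right; split.
  + by exists X.
  + move=> a b [Z1 G1 Za] [Z2 G2 Zb].
    have [h|h] := Gtot _ _ G1 G2.
      by exists Z2 => //; have [_ + _ _ _] := good _ _ G2 Zb; apply=> //; exact: h.
    by exists Z1 => //; have [_ + _ _ _] := good _ _ G1 Za; apply=> //; exact: h.
  + move=> a b [Z1 G1 Za] [Z2 G2 Zb].
    have [h|h] := Gtot _ _ G1 G2.
      by exists Z2 => //; have [_ _ + _ _] := good _ _ G2 Zb; apply=> //; exact: h.
    by exists Z1 => //; have [_ _ + _ _] := good _ _ G1 Za; apply=> //; exact: h.
  + by exists X.
  + by move=> [Z GZ Zy]; have [_ _ _ _] := good _ _ GZ Zy; apply.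
- exfalso.
  refine (Amax [set x | exists p : {poly int}, x = (map_poly intr p).[t]]%classic _ _).
    rewrite A0; split=> // h; have := h 1; apply.
    by have [] := avoiding_base.
  by right; exact: avoiding_base.
- exists A => // B hB AB x Bx; apply: contrapT => nAx.
  by refine (Amax B _ _); [split=> // h; apply: nAx; exact: h|right].
Qed.

End ValuationRing.

Section MaximalRing.
Variable F : fieldExtType rat.
Variables (y : F) (A : set F).
Hypothesis hA : avoiding y A.
Hypothesis Amax :
  forall B, avoiding y B -> (A `<=` B)%classic -> (B `<=` A)%classic.

Let A1 : A 1. Proof. by case: hA. Qed.
Let AB a b : A a -> A b -> A (a - b). Proof. by case: hA => _ + _ _ _; exact. Qed.
Let AM a b : A a -> A b -> A (a * b). Proof. by case: hA => _ _ + _ _; exact. Qed.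
Let At : A y^-1. Proof. by case: hA. Qed.
Let Ay : ~ A y. Proof. by case: hA. Qed.
Let A0 : A 0. Proof. by rewrite -(subrr 1); exact: AB. Qed.
Let AN a : A a -> A (- a). Proof. by rewrite -sub0r; exact: AB. Qed.
Let AD a b : A a -> A b -> A (a + b).
Proof. by move=> ha hb; rewrite -[b]opprK; apply/AB/AN. Qed.
Let Asum (I : Type) (r : seq I) (P : pred I) (f : I -> F) :
  (forall i, P i -> A (f i)) -> A (\sum_(i <- r | P i) f i).
Proof. by move=> h; elim/big_rec: _ => // i x Pi hx; exact: AD (h _ Pi) hx. Qed.

Let y0 : y != 0. Proof. by apply/eqP => e; apply: Ay; rewrite e. Qed.
Let t := y^-1.

Let ty : t * y = 1. Proof. by rewrite mulVf. Qed.

Lemma one_add_neq0 c : A c -> 1 + t * c != 0.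
Proof.
move=> hc; apply/eqP => /(congr1 ( *%R y)).
rewrite mulr0 mulrDr mulr1 mulrA mulfV // mul1r => /eqP.
by rewrite addr_eq0 => /eqP e; apply: Ay; rewrite e; exact: AN.
Qed.

(* Localizing A at 1 + t A does not produce y, so A is already localized there. *)
Lemma one_add_inv c : A c -> A (1 + t * c)^-1.
Proof.
move=> hc.
pose B := [set x | exists2 b, A b & exists2 c, A c & x = b / (1 + t * c)]%classic.
apply: (Amax (B := B)); last by exists 1 => //; exists c => //; rewrite mul1r.
  split.
  - by exists 1 => //; exists 0 => //; rewrite mulr0 addr0 divr1.
  - move=> _ _ [b hb [e he ->]] [b' hb' [e' he' ->]].
    exists (b * (1 + t * e') - b' * (1 + t * e)).
      by apply: AB; apply: AM => //; apply: AD => //; apply: AM.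
    exists (e + e' + t * e * e'); first by do ![apply: AD | apply: AM => //].
    have n1 := one_add_neq0 he; have n2 := one_add_neq0 he'.
    have -> : 1 + t * (e + e' + t * e * e') = (1 + t * e) * (1 + t * e') by ring.
    by field; rewrite n1 n2.
  - move=> _ _ [b hb [e he ->]] [b' hb' [e' he' ->]].
    exists (b * b'); first exact: AM.
    exists (e + e' + t * e * e'); first by do ![apply: AD | apply: AM => //].
    have n1 := one_add_neq0 he; have n2 := one_add_neq0 he'.
    have -> : 1 + t * (e + e' + t * e * e') = (1 + t * e) * (1 + t * e') by ring.
    by field; rewrite n1 n2.
  - by exists t => //; exists 0 => //; rewrite mulr0 addr0 divr1.
  - move=> [b hb [e he ey]]; apply: Ay; have n1 := one_add_neq0 he.
    suff -> : y = b - e by exact: AB.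
    move/(congr1 (fun z => z * (1 + t * e))): ey.
    rewrite divfK // mulrDr mulr1 mulrA mulfV // mul1r => <-.
    by rewrite addrK.
by move=> x hx; exists x => //; exists 0 => //; rewrite mulr0 addr0 divr1.
Qed.

(* By maximality, x is outside A only if 1 lies in t A[x]. *)
Definition unit_comb (x : F) m := exists2 a : nat -> F, (forall i, A (a i)) &
  1 = t * \sum_(i < m.+1) a i * x ^+ i.

Lemma unit_combW x m m' : (m <= m')%N -> unit_comb x m -> unit_comb x m'.
Proof.
move=> /subnK <-; elim: (m' - m)%N => // k IH h.
case: (IH h) => a ha e; exists (fun i => if (i <= k + m)%N then a i else 0).
  by move=> i; case: ifP.
rewrite e; congr (_ * _); rewrite [RHS]big_ord_recr /= addSn ltnn mul0r addr0.
by apply: eq_bigr => i _; have -> : (i <= k + m)%N by rewrite -ltnS.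
Qed.

(** Multiplied by x^(m+1), the relation for 1/x writes (1 - t b_0) x^(m+1) in terms of lower powers
    of x. As 1 - t b_0 is invertible in A by [one_add_inv], the leading term of the relation for x
    can be eliminated. *)
Lemma unit_comb_descent x m : x != 0 ->
  unit_comb x m.+1 -> unit_comb x^-1 m.+1 -> unit_comb x m.
Proof.
move=> x0 [a ha ea] [b hb eb].
have hc := one_add_inv (AN (hb 0%N)); have nz := one_add_neq0 (AN (hb 0%N)).
set u := _^-1 in hc.
have xm : x ^+ m.+1 = \sum_(i < m.+1) t * u * b (m.+1 - i)%N * x ^+ i.
  have e1 : 1 + t * - b 0%N = t * \sum_(i < m.+1) b i.+1 * x^-1 ^+ i.+1.
    rewrite {1}eb big_ord_recl /= expr0 mulr1 /bump /=; ring.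
  have -> : x ^+ m.+1 = u * (1 + t * - b 0%N) * x ^+ m.+1 by rewrite mulVf ?mul1r.
  rewrite e1 (reindex_inj rev_ord_inj) /= [u * _]mulrA [u * t]mulrC mulr_sumr mulr_suml.
  apply: eq_bigr => i _; rewrite -!mulrA; congr (_ * (_ * _)).
  have im : (i < m.+1)%N by [].
  rewrite subSS subSn; last by rewrite -ltnS.
  congr (_ * _); have e2 : m.+1 = ((m - i).+1 + i)%N by lia.
  rewrite {2}e2 exprD mulrA -exprMn mulVf // expr1n mul1r //.
exists (fun i => a i + a m.+1 * (t * u * b (m.+1 - i)%N)).
  by move=> i; apply: AD => //; do ![apply: AM => //].
rewrite ea; congr (_ * _); rewrite big_ord_recr /= xm mulr_sumr -big_split /=.
by apply: eq_bigr => i _; rewrite mulrDl !mulrA.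
Qed.

(** By symmetry both degrees drop together; in degree 0 the relation 1 = t a gives y = a in A. *)
Lemma unit_combF x m : x != 0 -> unit_comb x m -> unit_comb x^-1 m -> False.
Proof.
move=> x0; elim: m => [|m IH] h1 h2.
  case: h1 => a ha; rewrite big_ord1 expr0 mulr1 => /(congr1 ( *%R y)).
  by rewrite mulr1 mulrA mulfV // mul1r => e; apply: Ay; rewrite e.
apply: IH; first exact: unit_comb_descent h1 h2.
by apply: unit_comb_descent h2 _; rewrite ?invr_eq0 // invrK.
Qed.

Lemma unit_comb_exists x : ~ A x -> exists m, unit_comb x m.
Proof.
move=> hx; apply: contrapT => h; apply: hx.
pose B := [set z | exists p : {poly F}, (forall i, A p`_i) /\ z = p.[x]]%classic.
apply: (Amax (B := B)).
- split.
  + exists 1; rewrite hornerC; split=> // i.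
    by rewrite coefC; case: ifP.
  + move=> _ _ [p [hp ->]] [q [hq ->]]; exists (p - q); rewrite !hornerE; split=> // i.
    by rewrite coefB; exact: AB.
  + move=> _ _ [p [hp ->]] [q [hq ->]]; exists (p * q); rewrite !hornerE; split=> // i.
    by rewrite coefM; apply: Asum => j _; exact: AM.
  + exists t%:P; rewrite hornerC; split=> // i.
    by rewrite coefC; case: ifP.
  + move=> [p [hp e]]; apply: h; exists (size p); exists (fun i => p`_i) => //.
    by rewrite -(@horner_coef_wide _ (size p).+1) // -e ty.
- move=> z hz; exists z%:P; rewrite hornerC; split=> // i.
  by rewrite coefC; case: ifP.
- exists 'X; rewrite hornerX; split=> // i.
  by rewrite coefX; case: eqP => _.
Qed.

Lemma valuation_ring x : A x \/ A x^-1.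
Proof.
have [h1|/unit_comb_exists[m1 h1]] := pselect (A x); first by left.
have [h2|/unit_comb_exists[m2 h2]] := pselect (A x^-1); first by right.
have x0 : x != 0.
  apply/eqP => e; case: h1 => a _; rewrite e => e1; move: h2.
  rewrite e invr0 => -[a' ha']. rewrite big_ord_recl expr0 mulr1 big1 ?addr0 => [e2|i _].
    by exfalso; apply: Ay; rewrite -[y]mulr1 e2 mulrA mulfV // mul1r.
  by rewrite /= expr0n mulr0.
exfalso; apply: (unit_combF (m := maxn m1 m2) x0).
  exact: unit_combW (leq_maxl _ _) h1.
exact: unit_combW (leq_maxr _ _) h2.
Qed.

End MaximalRing.

(** * Valuation rings of a number field are discrete *)

Section DiscreteValuation.
Variable F : fieldExtType rat.
Variables (A : set F) (y : F).
Hypothesis A1 : A 1.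
Hypothesis AB : forall a b, A a -> A b -> A (a - b).
Hypothesis AM : forall a b, A a -> A b -> A (a * b).
Hypothesis Ay : ~ A y.
Hypothesis Aval : forall x, A x \/ A x^-1.

Let A0 : A 0. Proof. by rewrite -(subrr 1); exact: AB. Qed.
Let AN a : A a -> A (- a). Proof. by rewrite -sub0r; exact: AB. Qed.
Let AD a b : A a -> A b -> A (a + b).
Proof. by move=> ha hb; rewrite -[b]opprK; apply/AB/AN. Qed.
Let AX a n : A a -> A (a ^+ n).
Proof. by move=> ha; elim: n => [|n IH]; rewrite ?expr0 // exprS; exact: AM. Qed.
Let Anat n : A n%:R.
Proof. by elim: n => // n IH; rewrite -natr1; exact: AD. Qed.
Let Aint (k : int) : A k%:~R.
Proof. by case: k => n; rewrite ?NegzE ?mulrNz; [|apply: AN]; exact: Anat. Qed.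
Let At : A y^-1. Proof. by case: (Aval y). Qed.

Let U z := A z /\ A z^-1.

Let UM a b : U a -> U b -> U (a * b).
Proof. by move=> [a1 a2] [b1 b2]; rewrite /U invfM; split; exact: AM. Qed.
Let UV a : U a -> U a^-1. Proof. by rewrite /U invrK => -[]. Qed.
Let UX a n : U a -> U (a ^+ n).
Proof. by move=> [a1 a2]; rewrite /U -exprVn; split; exact: AX. Qed.
Let UN a : U a -> U (- a).
Proof. by move=> [a1 a2]; rewrite /U invrN; split; exact: AN. Qed.

(** The non-units of a valuation ring form an ideal: of two nonzero elements one divides the other,
    hence divides the sum, so a unit sum would make it a unit. *)
Lemma noninvertible_sum (I : Type) (r : seq I) (P : pred I) (f : I -> F) :
  (forall i, P i -> A (f i)) ->
  (forall i, P i -> forall b, A b -> f i * b != 1) ->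
  forall b, A b -> (\sum_(i <- r | P i) f i) * b != 1.
Proof.
move=> h1 h2; set s := \sum_(_ <- _ | _) _.
suff [] : A s /\ forall b, A b -> s * b != 1 by [].
rewrite /s; elim/big_rec: _ => [|i x Pi [hx nx]].
  by split=> // b _; rewrite mul0r eq_sym oner_neq0.
split=> [|b hb]; first by apply: AD => //; exact: h1.
have [->|x0] := eqVneq x 0; first by rewrite addr0 h2.
have [->|f0] := eqVneq (f i) 0; first by rewrite add0r nx.
have [h|] := Aval (f i / x).
  have -> : (f i + x) * b = x * ((f i / x + 1) * b).
    by rewrite mulrA mulrDr mulr1 mulrCA divff // mulr1.
  by apply: nx; apply: AM => //; exact: AD.
rewrite invf_div => h.
have -> : (f i + x) * b = f i * ((1 + x / f i) * b).
  by rewrite mulrA mulrDr mulr1 mulrCA divff // mulr1.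
by apply: h2 => //; apply: AM => //; exact: AD.
Qed.

(** If A contained every 1/n, the leading coefficient of a polynomial killing y would be invertible
    in A. The tails lie in A because 1/y does, so y would be in A. The least n with 1/n outside A is
    prime, because A is closed under products. *)
Lemma residue_prime : exists2 p : nat, prime p & ~ A p%:R^-1.
Proof.
have ex : exists n : nat, (0 < n)%N && ~~ `[< A n%:R^-1 >].
  apply: contrapT => h.
  have An n : A n%:R^-1.
    case: n => [|n]; first by rewrite invr0.
    by apply: contrapT => hn; apply: h; exists n.+1; apply/asboolPn.
  have [q [cq _ qy]] := primitive_int_root y; apply: Ay.
  have hA k : A (htail q y k).
    elim: k => [|k IH]; first by rewrite htail0.
    have y0 : y != 0 by apply/eqP => e; apply: Ay; rewrite e.
    have -> : htail q y k.+1 = (htail q y k - (q`_k)%:~R) * y^-1.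
      by rewrite (htailS q y k) [_ + y * _]addrC addrK mulrC mulKf.
    by apply: AM => //; exact: AB.
  have q0 : q != 0 by apply: contra_eq_neq cq => ->; rewrite zcontents0.
  case es : (size q) => [|[|n]].
  - by move/eqP: es; rewrite size_poly_eq0 (negPf q0).
  - move: qy; rewrite (size1_polyC (eq_leq es)) map_polyC hornerC /= => /eqP.
    rewrite intF_eq0 => c0; move/eqP: q0; case.
    by rewrite (size1_polyC (eq_leq es)) (eqP c0) polyC0.
  have e1 : htail q y n.+1 = (lead_coef q)%:~R.
    by rewrite htailS htail_big ?es // mulr0 addr0 lead_coefE es.
  have c0 : (lead_coef q)%:~R != 0 :> F by rewrite intF_eq0 lead_coef_eq0.
  have -> : y = (htail q y n - (q`_n)%:~R) * ((lead_coef q)%:~R)^-1.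
    by rewrite (htailS q y n) [_ + y * _]addrC addrK e1 mulfK.
  apply: AM; first exact: AB.
  case: (lead_coef q) => k; rewrite ?NegzE ?mulrNz ?invrN; first exact: An.
  by apply: AN; exact: An.
case: (ex_minnP ex) => p /andP[p0 /asboolPn pA] pmin; exists p => //.
have An n : (n < p)%N -> A n%:R^-1.
  case: n => [|n] np; first by rewrite invr0.
  apply: contrapT => /asboolPn hn; have := pmin n.+1.
  by rewrite hn => /(_ isT); rewrite leqNgt np.
apply/primeP; split.
  by case: p p0 pA {pmin An} => [|[|p]] // _; rewrite invr1.
move=> d /dvdnP[e pe]; have d0 : (0 < d)%N by move: p0; rewrite pe muln_gt0 => /andP[].
have e0 : (0 < e)%N by move: p0; rewrite pe muln_gt0 => /andP[].
have [e1|e1] := eqVneq e 1%N; first by rewrite pe e1 mul1n eqxx orbT.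
have [//|d1] := eqVneq d 1%N; exfalso; apply: pA.
by rewrite pe natrM invfM; apply: AM; apply: An; rewrite pe; nia.
Qed.

Variable p : nat.
Hypothesis pp : prime p.
Hypothesis pA : ~ A p%:R^-1.

Let p0 : p%:R != 0 :> F. Proof. by rewrite natF_eq0 -lt0n prime_gt0. Qed.

(** With u p = v n + 1: if n/p were in A, so would be 1/p = u - v (n/p); hence p/n is in A, and so
    is 1/n = u (p/n) - v. *)
Let U_nat n : coprime p n -> U n%:R.
Proof.
move=> cpn; split=> //; have n0 : (0 < n)%N.
  by case: n cpn => // ; rewrite /coprime gcdn0 => /eqP e; move: pp; rewrite e.
have n0F : n%:R != 0 :> F by rewrite natF_eq0 -lt0n.
case: (egcdnP n (prime_gt0 pp)) => u v e _.
move: cpn; rewrite /coprime => /eqP cpn; rewrite cpn in e.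
have e' : (u%:R * p%:R : F) = v%:R * n%:R + 1 by rewrite -!natrM e natrD.
have [h|] := Aval (n%:R / p%:R).
  exfalso; apply: pA.
  have -> : p%:R^-1 = u%:R - v%:R * (n%:R / p%:R) :> F.
    apply: (mulIf p0); rewrite mulVf // mulrBl e' -mulrA divfK //; ring.
  by apply: AB => //; exact: AM.
rewrite invf_div => h.
have -> : n%:R^-1 = u%:R * (p%:R / n%:R) - v%:R :> F.
  by apply: (mulIf n0F); rewrite mulVf // mulrBl -mulrA divfK // e'; ring.
by apply: AB => //; exact: AM.
Qed.

Let U_int (k : int) : k != 0 -> exists e : nat, U (k%:~R / p%:R ^+ e).
Proof.
move=> k0; suff [e he] : exists e : nat, U (`|k|%N%:R / p%:R ^+ e).
  exists e; case: k {k0} he => n //=; rewrite NegzE mulrNz mulNr => h; exact: UN.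
have k1 : (0 < `|k|)%N by rewrite absz_gt0.
have [m cm ->] := pfactor_coprime pp k1.
exists (logn p `|k|); rewrite natrM natrX mulfK ?expf_neq0 //.
exact: U_nat.
Qed.

Let min_term (s : seq F) : all (fun x => x != 0) s -> s != [::] ->
  exists2 x, x \in s & forall z, z \in s -> A (z / x).
Proof.
elim: s => // a [|b s] IH /andP[a0 hs] _.
  by exists a => [|z]; rewrite inE // => /eqP ->; rewrite divff.
have [//|//|x xs xmin] := IH.
have x0 : x != 0 by have /allP/(_ _ xs) : all (fun x => x != 0) (b :: s) by [].
have [h|] := Aval (a / x).
  exists x; first by rewrite inE xs orbT.
  by move=> z; rewrite inE => /orP[/eqP ->//|]; exact: xmin.
rewrite invf_div => h; exists a; first by rewrite inE eqxx.
move=> z; rewrite inE => /orP[/eqP ->|/xmin hz]; first by rewrite divff.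
have -> : z / a = (z / x) * (x / a) by rewrite mulrA divfK.
exact: AM.
Qed.

(* In a vanishing sum of terms q_i x^i two terms have the same valuation, so some
   x^j with j <= [F : Q] is a unit times a power of p.  With E = [F : Q]! this
   holds for x^E uniformly in x, which makes the value group discrete. *)
Let U_root x : x != 0 -> exists2 j, (0 < j <= \dim {:F})%N &
  exists a : int, U (x ^+ j * p%:R ^ a).
Proof.
move=> x0; have [q [cq sq qx]] := primitive_int_root x.
have q0 : q != 0 by apply: contra_eq_neq cq => ->; rewrite zcontents0.
pose T i : F := (q`_i)%:~R * x ^+ i.
pose s := [seq i <- iota 0 (size q) | q`_i != 0].
have T0 i : i \in s -> T i != 0.
  by rewrite mem_filter => /andP[hi _]; rewrite mulf_neq0 ?intF_eq0 ?expf_neq0.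
have [z0 /mapP[i si ->] imin] : exists2 z, z \in map T s &
    forall z', z' \in map T s -> A (z' / z).
  apply: min_term; first by rewrite all_map; apply/allP => i /T0.
  have : (size q).-1 \in s.
    rewrite mem_filter -lead_coefE lead_coef_eq0 q0 mem_iota /= add0n.
    by rewrite ltn_predL lt0n size_poly_eq0.
  by case: s {T0}.
have sum0 : \sum_(j <- s) T j / T i = 0.
  rewrite -mulr_suml big_filter big_mkcond /=.
  suff -> : \sum_(j <- iota 0 (size q)) (if q`_j != 0 then T j else 0) = 0
    by rewrite mul0r.
  rewrite -{}[RHS]qx (@horner_coef_wide _ (size q)); last first.
    by rewrite size_map_poly_id0 // intF_eq0 lead_coef_eq0.
  rewrite -(big_mkord predT (fun j => (map_poly intr q)`_j * x ^+ j)) /index_iota subn0.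
  apply: eq_bigr => j _; rewrite coef_map /= /T; case: eqP => //= ->.
  by rewrite mulr0z mul0r.
have us : uniq s by rewrite filter_uniq // iota_uniq.
(* [T i] divides all other terms. If no other quotient [T j / T i] were a unit, these non-units
   would add up to -1, against [noninvertible_sum]. *)
have [j [js ij Uij]] : exists j, [/\ j \in s, j != i & U (T j / T i)].
  apply: contrapT => h.
  have := @noninvertible_sum _ s (fun j => (j \in s) && (j != i)) (fun j => T j / T i).
  move=> /(_ _ _ (-1) (AN A1)) H.
  have := sum0; rewrite (bigD1_seq i) //= divff ?T0 // => /eqP.
  rewrite addr_eq0 => /eqP e.
  have : \sum_(j0 <- s | (j0 \in s) && (j0 != i)) T j0 / T i * -1 != 1.
    rewrite -mulr_suml; apply: H => j /andP[js ji].
      by apply: imin; exact: map_f.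
    move=> b hb; apply/eqP => eb; apply: h; exists j; split=> //; split.
      by apply: imin; exact: map_f.
    have nz : T j / T i != 0 by rewrite mulf_neq0 ?invr_eq0 ?T0.
    by rewrite -[_^-1]mulr1 -eb mulKf.
  rewrite -mulr_suml mulrN1 -big_seq_cond; case/eqP; exact/esym.
have ss k : k \in s -> (k <= \dim {:F})%N.
  rewrite mem_filter mem_iota => /andP[_ /andP[_]]; rewrite add0n => h.
  by rewrite -ltnS (leq_trans h sq).
wlog lij : i j si js ij Uij {imin sum0} / (i < j)%N => [H|].
  have [lij|] := ltnP i j; first exact: (H i j).
  rewrite leq_eqVlt (negPf ij) /= => lji; apply: (H j i) => //; first by rewrite eq_sym.
  by rewrite -invf_div; exact: UV.
exists (j - i)%N; first by rewrite subn_gt0 lij (leq_trans (leq_subr _ _) (ss _ js)).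
have qj : q`_j != 0 by move: js; rewrite mem_filter => /andP[].
have qi : q`_i != 0 by move: si; rewrite mem_filter => /andP[].
have [ej Uj] := U_int qj; have [ei Ui] := U_int qi.
exists (ej%:Z - ei%:Z).
have -> : x ^+ (j - i) * p%:R ^ (ej%:Z - ei%:Z) = (T j / T i)
   * ((q`_j)%:~R / p%:R ^+ ej)^-1 * ((q`_i)%:~R / p%:R ^+ ei).
  have exj : x ^+ j = x ^+ (j - i) * x ^+ i by rewrite -exprD subnK // ltnW.
  rewrite /T expfzDr // -exprnN -exprnP exj.
  have n1 : (q`_j)%:~R != 0 :> F by rewrite intF_eq0.
  have n2 : (q`_i)%:~R != 0 :> F by rewrite intF_eq0.
  have n3 : x ^+ i != 0 by rewrite expf_neq0.
  have n4 : p%:R ^+ ej != 0 :> F by rewrite expf_neq0.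
  have n5 : p%:R ^+ ei != 0 :> F by rewrite expf_neq0.
  by field; rewrite n1 n2 n3 n4 n5.
by apply: UM => //; apply: UM => //; exact: UV.
Qed.

Let E := (\dim {:F})`!.

Let U_fact x : x != 0 -> exists a : int, U (x ^+ E / p%:R ^ a).
Proof.
move=> /U_root[j hj [a ha]].
have /dvdnP[k ek] := dvdn_fact hj.
exists (- (a * k)); rewrite /E ek mulnC exprM.
have -> : x ^+ j ^+ k / p%:R ^ (- (a * k)) = (x ^+ j * p%:R ^ a) ^+ k.
  by rewrite invr_expz opprK exprMn (exprnP (_ ^ a)) exprz_exp.
exact: UX.
Qed.

Let U_pow_eq0 (a : int) : U (p%:R ^ a) -> a = 0.
Proof.
have pos n : ~ U (p%:R ^+ n.+1).
  move=> [_ h]; apply: pA.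
  have -> : p%:R^-1 = p%:R ^+ n * (p%:R ^+ n.+1)^-1 :> F.
    have n1 : p%:R ^+ n != 0 :> F by rewrite expf_neq0.
    by rewrite exprS; field; rewrite p0 n1.
  by apply: AM => //; exact: AX.
case: a => [[//|n]|n] h; first by case: (pos n).
by case: (pos n); rewrite -[_ ^+ _]invrK; apply: UV; rewrite exprnN.
Qed.

(** This is E times the valuation normalized to be 1 at p; [U_fact] says that the factor E makes it
    integral. *)
Let v x : int :=
  if x == 0 then 0 else xget 0 [set a : int | U (x ^+ E / p%:R ^ a)]%classic.

Let vP x : x != 0 -> U (x ^+ E / p%:R ^ (v x)).
Proof.
move=> x0; rewrite /v (negPf x0); case: xgetP => [a _ //|h].
by have [a ha] := U_fact x0; case: (h a).
Qed.

Let v_uniq x a : x != 0 -> U (x ^+ E / p%:R ^ a) -> v x = a.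
Proof.
move=> x0 ha; apply/eqP; rewrite -subr_eq0; apply/eqP/U_pow_eq0.
have -> : p%:R ^ (v x - a) = (x ^+ E / p%:R ^ a) * (x ^+ E / p%:R ^ (v x))^-1.
  rewrite expfzDr // -invr_expz.
  have n1 : x ^+ E != 0 by rewrite expf_neq0.
  have n2 : p%:R ^ a != 0 :> F by rewrite expfz_neq0.
  have n3 : p%:R ^ (v x) != 0 :> F by rewrite expfz_neq0.
  move: (x ^+ E) (p%:R ^ a) (p%:R ^ v x) n1 n2 n3 => X Y Z n1 n2 n3.
  by field; rewrite n1 n2 n3.
by apply: UM => //; apply: UV; exact: vP.
Qed.

Let vM a b : a != 0 -> b != 0 -> v (a * b) = v a + v b.
Proof.
move=> a0 b0; apply: v_uniq; first by rewrite mulf_neq0.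
have -> : (a * b) ^+ E / p%:R ^ (v a + v b)
   = (a ^+ E / p%:R ^ (v a)) * (b ^+ E / p%:R ^ (v b)).
  by rewrite expfzDr // invfM exprMn mulrACA.
by apply: UM; exact: vP.
Qed.

Let A_root x n : A (x ^+ n.+1) -> A x.
Proof.
move=> h; case: (Aval x) => // hV; have [->//|x0] := eqVneq x 0.
have -> : x = x ^+ n.+1 * x^-1 ^+ n by rewrite exprS -mulrA -exprMn mulfV // expr1n mulr1.
by apply: AM => //; exact: AX.
Qed.

Let v_ge0 x : x != 0 -> 0 <= v x -> A x.
Proof.
move=> x0; case ev : (v x) => [n|//] _.
have := vP x0; rewrite ev -exprnP => -[h _].
have : A (x ^+ E).
  rewrite -[x ^+ E](divfK (_ : p%:R ^+ n != 0)) ?expf_neq0 //.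
  by apply: AM => //; exact: AX.
have : (0 < E)%N by rewrite fact_gt0.
by case: E => // e _; exact: A_root.
Qed.

Let v_le0 x : x != 0 -> A x -> 0 <= v x.
Proof.
move=> x0 hx; case ev : (v x) => [n|n] //; exfalso; apply: pA.
have := vP x0; rewrite ev NegzE -exprnN invrK => -[_].
rewrite invfM => h; have h' : A (p%:R ^+ n.+1)^-1.
  have -> : (p%:R ^+ n.+1)^-1 = x ^+ E * ((x ^+ E)^-1 / p%:R ^+ n.+1) :> F.
    by rewrite mulrA divff ?mul1r // expf_neq0.
  by apply: AM => //; exact: AX.
by apply: (@A_root _ n); rewrite exprVn.
Qed.

Lemma valuation_ring_ord : exists2 w, is_ord w & w y < 0.
Proof.
have vV x : x != 0 -> v x^-1 = - v x.
  move=> x0; have := vM x0 (_ : x^-1 != 0); rewrite invr_eq0 divff // => /(_ x0).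
  have -> : v 1 = 0.
    have := vM (oner_neq0 F) (oner_neq0 F); rewrite mulr1 => e.
    by apply: (addrI (v 1)); rewrite addr0 -e.
  lia.
have [||||w hw [c c0 vw]] := @normalize_ord F v.
- by rewrite /v eqxx.
- exact: vM.
- move=> a b a0 b0 ab0.
  wlog h : a b a0 b0 ab0 / A (a / b).
    move=> H; case: (Aval (a / b)) => [|h]; first exact: H.
    by rewrite minC addrC; apply: H => //; rewrite 1?addrC // -invf_div.
  rewrite ge_min; apply/orP; right.
  have e : a + b = b * (a / b + 1) by rewrite mulrDr mulr1 mulrCA divff // mulr1.
  have n0 : a / b + 1 != 0 by apply: contraNneq ab0 => e0; rewrite e e0 mulr0.
  by rewrite e vM // lerDl; apply: v_le0 => //; exact: AD.
- exists p%:R => //; apply/eqP => e; apply: pA; apply: v_ge0; rewrite ?invr_eq0 //.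
  by rewrite vV // e.
exists w => //; have y0 : y != 0 by apply/eqP => e; apply: Ay; rewrite e.
rewrite ltNge; apply/negP => h; apply: Ay; apply: v_ge0 => //.
by rewrite vw mulr_ge0 // ltW.
Qed.

End DiscreteValuation.

Theorem inO_integral (F : fieldExtType rat) (x : F) :
  inO x -> integralOver (intr : int -> F) x.
Proof.
move=> hx; apply: contrapT => hn.
have [A hA Amax] := maximal_avoiding hn.
have Aval := valuation_ring hA Amax.
case: hA => A1 AB AM _ Ax.
have [p pp pA] := residue_prime A1 AB AM Ax Aval.
have [w hw wx] := valuation_ring_ord A1 AB AM Ax Aval pp pA.
have := hx w hw; rewrite /vge leNgt wx orbF => /eqP x0.
by move: wx; rewrite x0 ord_zero.
Qed.

(** * Embeddings and the norm *)

Section Embeddings.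
Variables (F : fieldExtType rat) (R : realType).
Implicit Types (x : F).

(** The leading coefficient of p is its last nonzero tail, and x times a tail is integral. *)
Lemma inO_multiple x : exists2 m : int, m != 0 & inO (m%:~R * x).
Proof.
have [p [cp _ px]] := primitive_int_root x.
have p0 : p != 0 by apply: contra_eq_neq cp => ->; rewrite zcontents0.
exists (lead_coef p); first by rewrite lead_coef_eq0.
case es : (size p) => [|[|n]].
- by move/eqP: es; rewrite size_poly_eq0 (negPf p0).
- move: px; rewrite (size1_polyC (eq_leq es)) map_polyC hornerC /= => /eqP.
  rewrite intF_eq0 => c0; move/eqP: p0; case.
  by rewrite (size1_polyC (eq_leq es)) (eqP c0) polyC0.
have -> : (lead_coef p)%:~R = htail p x n.+1.
  by rewrite htailS htail_big ?es // mulr0 addr0 lead_coefE es.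
by rewrite mulrC; exact: inO_mul_htail.
Qed.

Lemma is_emb_rmorphism (s : F -> R[i]) :
  is_emb s -> exists f : {rmorphism F -> R[i]}, s = f :> (F -> R[i]).
Proof.
move=> [s1 [sD sM]].
have s0 : s 0 = 0 by apply: (addrI (s 0)); rewrite -sD !addr0.
have sN x : s (- x) = - s x by apply/eqP; rewrite -addr_eq0 -sD addNr s0.
have sB : zmod_morphism s by move=> x y; rewrite sD sN.
have sm : monoid_morphism s by split.
pose za := GRing.isZmodMorphism.Build F R[i] s sB.
pose ma := GRing.isMonoidMorphism.Build F R[i] s sm.
pose f : {rmorphism F -> R[i]} := HB.pack s za ma.
by exists f.
Qed.

Lemma rmorphism_is_emb (f : {rmorphism F -> R[i]}) : is_emb f.
Proof. by split; [exact: rmorph1|split=> x y; [exact: rmorphD|exact: rmorphM]]. Qed.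

Lemma rmorph_in_alg (f : {rmorphism F -> R[i]}) (a : rat) : f (a%:A) = ratr a.
Proof. exact: (fmorph_eq_rat (f \o GRing.in_alg F)). Qed.

(** A primitive element of F over Q, multiplied by an integer to make it integral. *)
Lemma integral_generator : exists2 th : F, inO th &
  forall x, exists q : {poly rat}, x = (map_poly (GRing.in_alg F) q).[th].
Proof.
have ch0 : has_pchar0 F.
  move=> p; rewrite !inE; apply/negbTE; rewrite negb_and natF_eq0.
  by case: p => [|p]; rewrite ?orbT.
have sep : separable (1%AS : {subfield F}) {:F}%AS.
  by apply/separableP => x _; exact: pcharf0_separable.
have gen := eq_adjoin_separable_generator sep (subvf _).
set th := separable_generator _ _ in gen.
have [m m0 mth] := inO_multiple th; exists (m%:~R * th) => // x.
have : x \in <<1%AS; th>>%VS by rewrite -gen memvf.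
case/Fadjoin_polyP => p /polyOver1P[q ->] ->.
exists (q \Po (m%:~R^-1 *: 'X)).
rewrite map_comp_poly horner_comp map_polyZ map_polyX hornerZ hornerX.
rewrite fmorphV rmorph_int mulrA mulVf ?mul1r //.
by rewrite intF_eq0.
Qed.

(** Stands in for an integral basis: [om] generates a subgroup of O of full rank, possibly smaller
    than O. The determinant makes [om] independent and the embeddings distinct, so D = [F : Q]. *)
Definition integral_frame (D : nat)
    (sigma : 'I_D -> {rmorphism F -> R[i]}) (om : 'I_D -> F) :=
  [/\ (0 < D)%N,
      (forall s, is_emb s -> exists i, s = sigma i :> (F -> R[i])),
      (forall j, inO (om j)),
      \det (\matrix_(j, i) sigma i (om j)) != 0 &
      forall x, exists c : 'I_D -> rat, x = \sum_j (c j)%:A * om j].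

(** The powers of an integral generator th, with one embedding for each complex root of its minimal
    polynomial. The roots are distinct by separability, so the determinant is a nonzero Vandermonde
    determinant. *)
Theorem integral_frame_exists : exists (D : nat)
  (sigma : 'I_D -> {rmorphism F -> R[i]}) (om : 'I_D -> F),
  integral_frame sigma om.
Proof.
have [th oth gen] := integral_generator.
have /polyOver1P[q eq_q] := minPolyOver 1%AS th.
have qmon : q \is monic by rewrite -(map_monic (GRing.in_alg F)) -eq_q monic_minPoly.
have [r qr] := closed_field_poly_normal (map_poly ratr q : {poly R[i]}).
have ur : uniq r.
  rewrite -separable_prod_XsubC -[\prod_(_ <- _) _]scale1r.
  have lc1 : lead_coef (map_poly ratr q : {poly R[i]}) = 1.
    by apply/monicP; rewrite map_monic.
  rewrite -lc1 -qr separable_map -(separable_map (GRing.in_alg F)) -eq_q.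
  have ch0 : has_pchar0 F.
    move=> p; rewrite !inE; apply/negbTE; rewrite negb_and natF_eq0.
    by case: p => [|p]; rewrite ?orbT.
  exact: (pcharf0_separable 1%AS ch0 th).
have qth (p : {poly rat}) : (map_poly (GRing.in_alg F) p).[th] = 0 -> q %| p.
  move=> /rootP rp; rewrite -(dvdp_map (GRing.in_alg F)) -eq_q.
  by apply: minPoly_dvdp => //; exact: alg_polyOver.
have rootr z : z \in r -> root (map_poly ratr q : {poly R[i]}) z.
  move=> zr; rewrite qr /root hornerZ horner_prod (big_rem z) //=.
  by rewrite hornerXsubC subrr mul0r mulr0.
have rroot z : root (map_poly ratr q : {poly R[i]}) z -> z \in r.
  have lc0 : lead_coef (map_poly ratr q : {poly R[i]}) != 0.
    by rewrite lead_coef_eq0 map_poly_eq0 monic_neq0.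
  by rewrite qr rootZ // root_prod_XsubC.
have [pol polP] := choice gen.
(* F is Q[X]/(q), so evaluation at a root of q is well defined on F; this is the embedding belonging
   to that root. *)
have wd z (p p' : {poly rat}) : z \in r ->
    (map_poly (GRing.in_alg F) p).[th] = (map_poly (GRing.in_alg F) p').[th] ->
    (map_poly ratr p : {poly R[i]}).[z] = (map_poly ratr p' : {poly R[i]}).[z].
  move=> /rootr rz e; apply/eqP; rewrite -subr_eq0 -hornerN -hornerD -rmorphB.
  have /dvdpP[u ->] : q %| p - p'.
    by apply: qth; rewrite rmorphB /= hornerD hornerN e subrr.
  by rewrite rmorphM /= hornerM (rootP rz) mulr0.
have ex (i : 'I_(size r)) : exists f : {rmorphism F -> R[i]}, f th = r`_i.
  pose s x : R[i] := (map_poly ratr (pol x)).[r`_i].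
  have ri : r`_i \in r by rewrite mem_nth.
  have es : is_emb s.
    split; last split.
    - rewrite /s (wd _ _ 1 ri) ?rmorph1 ?hornerC // -polP //.
    - move=> x y; rewrite /s (wd _ _ (pol x + pol y) ri) ?rmorphD ?hornerD //=.
      by rewrite -!polP.
    - move=> x y; rewrite /s (wd _ _ (pol x * pol y) ri) ?rmorphM ?hornerM //=.
      by rewrite -!polP.
  have [f fE] := is_emb_rmorphism es; exists f; rewrite -fE /s.
  by rewrite (wd _ _ 'X ri) ?map_polyX ?hornerX // -polP.
have [sigma sigmaP] := choice ex.
have sigma_pol (f : {rmorphism F -> R[i]}) (p : {poly rat}) :
    f (map_poly (GRing.in_alg F) p).[th] = (map_poly ratr p).[f th].
  rewrite -horner_map -map_poly_comp; congr (_.[_]).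
  by apply: eq_map_poly => a /=; rewrite rmorph_in_alg.
have szq : size q = (size r).+1.
  rewrite -(size_map_poly (ratr : {rmorphism rat -> R[i]})) qr.
  rewrite size_scale ?size_prod_XsubC // lead_coef_eq0 map_poly_eq0.
  exact: monic_neq0.
exists (size r), sigma, (fun j => th ^+ j); split.
- rewrite lt0n; apply/negP => /eqP r0.
  have sq1 : size q = 1 by rewrite szq r0.
  have /qth : (map_poly (GRing.in_alg F) q).[th] = 0.
    by rewrite -eq_q; apply/rootP/root_minPoly.
  have := root_minPoly 1%AS th; rewrite eq_q.
  have [c c0 ->] := size_poly1P _ (introT eqP sq1).
  by rewrite map_polyC rootC fmorph_eq0 (negPf c0).
- move=> s es; have [f fE] := is_emb_rmorphism es.
  have fr : f th \in r.
    apply: rroot; rewrite /root -sigma_pol -eq_q.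
    have /rootP -> := root_minPoly 1%AS th; by rewrite rmorph0.
  have ii : (index (f th) r < size r)%N by rewrite index_mem.
  exists (Ordinal ii); rewrite fE; apply/funext => x.
  by rewrite (polP x) !sigma_pol sigmaP /= nth_index.
- by move=> j; exact: inOX.
- have -> : \matrix_(j, i) sigma i (th ^+ j) = Vandermonde (size r) (\row_i r`_i).
    by apply/matrixP => j i; rewrite !mxE rmorphXn sigmaP.
  rewrite det_Vandermonde; apply/prodf_neq0 => i _; apply/prodf_neq0 => j ij.
  rewrite !mxE subr_eq0 nth_uniq //; by apply: contraTneq ij => ->; rewrite ltnn.
- move=> x; pose p := pol x %% q; exists (fun j => p`_j).
  have -> : x = (map_poly (GRing.in_alg F) p).[th].
    rewrite {1}(polP x) {1}(divp_eq (pol x) q) rmorphD rmorphM /= hornerD hornerM.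
    rewrite -eq_q; have /rootP -> := root_minPoly 1%AS th.
    by rewrite mulr0 add0r.
  rewrite (@horner_coef_wide _ (size r)); last first.
    by rewrite size_map_poly -ltnS -szq ltn_modp monic_neq0.
  by apply: eq_bigr => j _; rewrite coef_map.
Qed.

End Embeddings.

Local Notation normc := ComplexField.Normc.normc.

Lemma normc_ge0 (R : realType) (z : R[i]) : 0 <= normc z.
Proof. by case: z => a b; exact: sqrtr_ge0. Qed.

Lemma normc_gt0 (R : realType) (z : R[i]) : z != 0 -> 0 < normc z.
Proof.
move=> z0; rewrite lt_neqAle normc_ge0 andbT eq_sym.
by apply: contraNneq z0 => /ComplexField.Normc.eq0_normc ->.
Qed.

Lemma normcX (R : realType) (z : R[i]) n : normc (z ^+ n) = normc z ^+ n.
Proof.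
elim: n => [|n IH]; first by rewrite !expr0 ComplexField.Normc.normc1.
by rewrite !exprS ComplexField.Normc.normcM IH.
Qed.

Lemma normc_int (R : realType) (k : int) : normc (k%:~R : R[i]) = `|k%:~R : R|.
Proof.
have -> : (k%:~R : R[i]) = (k%:~R : R)%:C%C by rewrite rmorph_int.
by rewrite /= expr0n addr0 sqrtr_sqr.
Qed.

Lemma normc_prod (R : realType) (I : Type) (r : seq I) (f : I -> R[i]) :
  normc (\prod_(i <- r) f i) = \prod_(i <- r) normc (f i).
Proof.
elim: r => [|a r IH]; first by rewrite !big_nil ComplexField.Normc.normc1.
by rewrite !big_cons ComplexField.Normc.normcM IH.
Qed.

Lemma normc_le_sum (R : realType) (I : Type) (r : seq I) (f : I -> R[i]) :
  normc (\sum_(i <- r) f i) <= \sum_(i <- r) normc (f i).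
Proof.
elim: r => [|a r IH]; first by rewrite !big_nil ComplexField.Normc.normc0.
by rewrite !big_cons (le_trans (le_normcD _ _)) // lerD2l.
Qed.

Lemma normcD_le (R : realType) (x y : R[i]) : normc (x + y) <= normc x + normc y.
Proof. exact: le_normcD. Qed.

Lemma normc_conjc (R : realType) (z : R[i]) : normc (conjc z) = normc z.
Proof. by case: z => a b; rewrite /= sqrrN. Qed.

Lemma integral_rat (r : rat) :
  integralOver (intr : int -> rat) r -> exists k : int, r = k%:~R.
Proof.
move=> [p pmon /rootP pr].
have : (ratr r : algC) \in Aint.
  apply: (@root_monic_Aint (map_poly (intr : int -> algC) p)).
  - have -> : map_poly (intr : int -> algC) p = map_poly ratr (map_poly intr p).
      by rewrite -map_poly_comp; apply: eq_map_poly => k /=; rewrite ratr_int.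
    by rewrite /root horner_map pr rmorph0.
  - exact: monic_map.
  - by apply/polyOverP => i; rewrite coef_map /= intr_int.
move/(Cint_rat_Aint (Crat_rat r)) => /intrP[k e]; exists k.
by apply: (fmorph_inj (ratr : {rmorphism rat -> algC})); rewrite /= e ratr_int.
Qed.

(** * Norms of integral elements and the pigeonhole principle *)

Section Norm.
Variables (F : fieldExtType rat) (R : realType) (D : nat).
Variables (sigma : 'I_D -> {rmorphism F -> R[i]}) (om : 'I_D -> F).
Hypothesis hframe : integral_frame sigma om.

(** The product of the conjugates is the determinant of multiplication by x on the Q-basis [om],
    which W diagonalizes; so it is rational. It is also integral, as a product of integral
    conjugates, hence a nonzero integer. *)
Lemma norm_ge1 x : inO x -> x != 0 -> 1 <= \prod_i normc (sigma i x).
Proof.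
case: hframe => _ _ _ om_det om_span ox x0.
have [c cP] := choice (fun j => om_span (x * om j)).
pose M : 'M[rat]_D := \matrix_(j, k) c j k.
pose W : 'M[R[i]]_D := \matrix_(j, i) sigma i (om j).
have MW : map_mx ratr M *m W = W *m diag_mx (\row_i sigma i x).
  apply/matrixP => j i; rewrite mul_mx_diag !mxE -rmorphM mulrC cP rmorph_sum.
  by apply: eq_bigr => k _; rewrite !mxE rmorphM /= rmorph_in_alg.
have prodE : \prod_i sigma i x = ratr (\det M).
  apply: (mulfI om_det); rewrite -/W.
  have := congr1 determinant MW; rewrite !det_mulmx det_diag det_map_mx [LHS]mulrC => ->.
  by congr (_ * _); apply: eq_bigr => i _; rewrite mxE.
have [k ek] : exists k : int, \det M = k%:~R.
  apply: integral_rat.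
  have [p pmon /rootP pr] : integralOver (intr : int -> R[i]) (\prod_i sigma i x).
    elim/big_rec: _ => [|i z _ hz]; first exact: integral1.
    apply: integral_mul hz; have [p pmon /rootP pr] := inO_integral ox.
    exists p => //; apply/rootP.
    have -> : map_poly (intr : int -> R[i]) p = map_poly (sigma i) (map_poly intr p).
      by rewrite -map_poly_comp; apply: eq_map_poly => j /=; rewrite rmorph_int.
    by rewrite horner_map pr rmorph0.
  exists p => //; apply/rootP; apply: (fmorph_inj (ratr : {rmorphism rat -> R[i]})).
  rewrite rmorph0 -pr prodE -horner_map -map_poly_comp; congr (_.[_]).
  by apply: eq_map_poly => j /=; rewrite ratr_int.
have k0 : k != 0.
  apply/eqP => k0; have : \prod_i sigma i x != 0.
    by apply/prodf_neq0 => i _; rewrite fmorph_eq0.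
  by rewrite prodE ek k0 rmorph0 eqxx.
rewrite -normc_prod prodE ek ratr_int normc_int -intr_norm.
rewrite -[1]/(1%:~R) ler_int; lia.
Qed.

(** Bounds that depend only on the infinite place below an embedding. *)
Definition conj_invariant (d : 'I_D -> R) :=
  forall i j, (forall x, sigma j x = conjc (sigma i x)) -> d i = d j.

Lemma conj_index i : exists j, forall x, sigma j x = conjc (sigma i x).
Proof.
have h : is_emb (fun x => conjc (sigma i x)).
  by split; [rewrite !rmorph1|split=> x y; rewrite ?rmorphD ?rmorphM].
have [_ sigma_surj _ _ _] := hframe; have [j e] := sigma_surj _ h.
by exists j => x; rewrite -e.
Qed.

(* A complex conjugate pair contributes both Re + Im and Re - Im, so the D forms
   [ell i] are real coordinates on F (x) R without choosing an embedding per place. *)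
Definition ell i x : R := complex.Re (sigma i x) + complex.Im (sigma i x).

Lemma ellB i x y : ell i (x - y) = ell i x - ell i y.
Proof.
rewrite /ell rmorphB; case: (sigma i x) => a b; case: (sigma i y) => c d /=.
ring.
Qed.

Lemma ell_le i x : `|ell i x| <= 2 * normc (sigma i x).
Proof.
rewrite /ell; case: (sigma i x) => a b /=.
have ha : `|a| <= Num.sqrt (a ^+ 2 + b ^+ 2).
  by rewrite -sqrtr_sqr ler_wsqrtr // lerDl sqr_ge0.
have hb : `|b| <= Num.sqrt (a ^+ 2 + b ^+ 2).
  by rewrite -sqrtr_sqr ler_wsqrtr // lerDr sqr_ge0.
by rewrite (le_trans (ler_normD _ _)) // mulr2n mulrDl mul1r lerD.
Qed.

(** At conjugate indices the forms are a + b and a - b, and (a+b)^2 + (a-b)^2 = 2 (a^2 + b^2), so no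
    constant is lost. *)
Lemma normc_le_ell (d : 'I_D -> R) x : conj_invariant d ->
  (forall i, `|ell i x| <= d i) -> forall i, normc (sigma i x) <= d i.
Proof.
move=> dinv h i; have [j ej] := conj_index i.
have d0 : 0 <= d i by rewrite (le_trans _ (h i)).
have := h i; have := h j; rewrite -(dinv i j ej) /ell ej.
case: (sigma i x) => a b /=; rewrite !ler_norml => /andP[h1 h2] /andP[h3 h4].
rewrite -[leRHS]ger0_norm // -sqrtr_sqr ler_wsqrtr //; nra.
Qed.

(** The coordinates [ell i] lie in [-2 X_i, 2 X_i]; cutting this range into intervals of length d_i
    takes at most 4 X_i / d_i + 2 of them. The labels let congruence conditions be imposed at the
    same time. *)
Lemma pigeonhole (I L : finType) (f : I -> F) (lab : I -> L) (X d : 'I_D -> R) :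
  (forall i, 0 < d i) -> conj_invariant d ->
  (forall k i, normc (sigma i (f k)) <= X i) ->
  (0 < #|I|)%N ->
  #|L|%:R * \prod_i (4 * X i / d i + 2) < #|I|%:R :> R ->
  exists k k', [/\ k != k', lab k = lab k' &
    forall i, normc (sigma i (f k - f k')) <= d i].
Proof.
move=> d0 dinv hX I0 hcard.
pose m i := (Num.truncn (2 * X i / d i)).+1.
have X0 i : 0 <= X i.
  by have /card_gt0P[k _] := I0; rewrite (le_trans _ (hX k i)) // normc_ge0.
have z0 i : 0 <= 2 * X i / d i by rewrite divr_ge0 ?mulr_ge0 ?X0 // ltW.
have hm i : 2 * X i / d i < (m i)%:R by exact: truncnS_gt.
have hm2 i : (2 * m i)%:R <= 4 * X i / d i + 2.
  have : (Num.truncn (2 * X i / d i))%:R <= 2 * X i / d i by rewrite truncn_le.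
  rewrite natrM /m -natr1; have -> : 4 * X i / d i = 2 * (2 * X i / d i) by ring.
  lra.
pose fl i k := Num.floor (ell i (f k) / d i) + m i.
have fl_le i k : 0 <= fl i k < (2 * m i)%N.
  have := ell_le i (f k); have := hX k i => h1 h2.
  have : `|ell i (f k) / d i| < (m i)%:R.
    apply: le_lt_trans (hm i); rewrite normrM normfV (gtr0_norm (d0 i)).
    by rewrite ler_pM2r ?invr_gt0 // (le_trans h2) // ler_pM2l.
  rewrite ltr_norml => /andP[h3 h4].
  have : - (m i)%:Z <= Num.floor (ell i (f k) / d i).
    by rewrite floor_ge_int rmorphN /= ltW.
  have : Num.floor (ell i (f k) / d i) < (m i)%:Z by rewrite floor_lt_int.
  rewrite /fl; lia.
have flP i k : (`|fl i k| < 2 * m i)%N by have := fl_le i k; lia.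
pose g k : L * {dffun forall i, 'I_(2 * m i)} := (lab k, [ffun i => Ordinal (flP i k)]).
have : ~~ injectiveb g.
  apply/negP => /injectiveP ginj; have := leq_card g ginj.
  rewrite leqNgt => /negP; apply.
  rewrite -(ltr_nat R); apply: le_lt_trans hcard.
  rewrite card_prod natrM ler_wpM2l // card_dep_ffun foldrE big_map enumT.
  rewrite natr_prod; apply: ler_prod => i _; rewrite ler0n card_ord; exact: hm2.
move/injectivePn => [k [k' kk [e1 e2]]]; exists k, k'; split=> //.
apply: normc_le_ell => // i.
have : fl i k = fl i k'.
  have := congr1 (fun h : {dffun forall i, 'I_(2 * m i)} => val (h i)) e2.
  rewrite !ffunE /=; have := fl_le i k; have := fl_le i k'; lia.
move/addIr => e; rewrite ellB.
have := floor_itv (ell i (f k) / d i); have := floor_itv (ell i (f k') / d i).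
rewrite e intrD; set q := (Num.floor _)%:~R => /andP[h1 h2] /andP[h3 h4].
have : `|(ell i (f k) / d i) - (ell i (f k') / d i)| <= 1.
  rewrite ler_norml; apply/andP; split; lra.
by rewrite -mulrBl normrM normfV (gtr0_norm (d0 i)) ler_pdivrMr // mul1r.
Qed.

End Norm.

Lemma exists_root (R : realType) (y : R) n : 0 < y -> (0 < n)%N ->
  exists2 k : R, 0 < k & k ^+ n = y.
Proof.
move=> y0 n0; exists (y `^ n%:R^-1); first exact: powR_gt0.
rewrite -powR_mulrn ?powR_ge0 // -powRrM mulVf ?powRr1 ?ltW //.
by rewrite pnatr_eq0 -lt0n.
Qed.

Lemma exists_nat_bound (R : realType) (I : finType) (f : I -> R) :
  exists2 T : nat, (0 < T)%N & forall i, f i <= T%:R.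
Proof.
exists (Num.truncn (\sum_i `|f i|)).+1 => // i.
apply/ltW/(le_lt_trans _ (truncnS_gt _)); rewrite (bigD1 i) //=.
by rewrite (le_trans (ler_norm _)) // lerDl sumr_ge0.
Qed.

(** * The index of principal ideals and the places *)

Section Index.
Variables (F : fieldExtType rat) (R : realType) (D : nat).
Variables (sigma : 'I_D -> {rmorphism F -> R[i]}) (om : 'I_D -> F).
Hypothesis hframe : integral_frame sigma om.

Definition cubept T (k : {ffun 'I_D -> 'I_T}) : F := \sum_j (k j)%:R * om j.

Lemma inO_cubept T (k : {ffun 'I_D -> 'I_T}) : inO (cubept k).
Proof.
case: hframe => _ _ om_int _ _.
by apply: inO_sum => j _; apply: inOM => //; exact: inO_nat.
Qed.

Lemma cubept_inj T : injective (@cubept T).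
Proof.
move=> k k' e; case: hframe => _ _ _ om_det _.
pose W : 'M[R[i]]_D := \matrix_(j, i) sigma i (om j).
pose v : 'rV[R[i]]_D := \row_j ((k j)%:R - (k' j)%:R).
have vW : v *m W = 0.
  apply/rowP => i; rewrite !mxE.
  transitivity (sigma i (cubept k - cubept k')); last by rewrite e subrr rmorph0.
  rewrite /cubept -sumrB rmorph_sum; apply: eq_bigr => j _.
  by rewrite !mxE -mulrBl rmorphM rmorphB /= !rmorph_nat.
have v0 : v = 0.
  have uW : W \in unitmx by rewrite unitmxE unitfE.
  by rewrite -(mulmxK uW v) vW mul0mx.
apply/ffunP => j; apply/val_inj/eqP => /=.
move/rowP: v0 => /(_ j); rewrite !mxE => /eqP; rewrite subr_eq0.
by rewrite eqr_nat.
Qed.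

Let C1 : R := 1 + \sum_i \sum_j normc (sigma i (om j)).

Lemma cubept_bound : exists2 C : R, 1 <= C &
  forall T (k : {ffun 'I_D -> 'I_T}) i, normc (sigma i (cubept k)) <= C * T%:R.
Proof.
exists C1.
  rewrite lerDl sumr_ge0 // => i _; rewrite sumr_ge0 // => j _.
  exact: normc_ge0.
move=> T k i; rewrite /cubept rmorph_sum /= (le_trans (normc_le_sum _ _)) //.
apply: (@le_trans _ _ ((\sum_j normc (sigma i (om j))) * T%:R)).
  rewrite mulr_suml; apply: ler_sum => j _.
  rewrite rmorphM rmorph_nat ComplexField.Normc.normcM mulrC.
  rewrite ler_wpM2l ?normc_ge0 // -[(k j)%:R]/((k j : int)%:~R) normc_int.
  by rewrite -pmulrn normr_nat ler_nat ltnW.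
rewrite ler_wpM2r // /C1 [in leRHS](bigD1 i) //= addrCA lerDl addr_ge0 //.
by rewrite sumr_ge0 // => i' _; rewrite sumr_ge0 // => j _; exact: normc_ge0.
Qed.

Lemma conj_invariant_normc (c : R) z : conj_invariant sigma (fun i => c * normc (sigma i z)).
Proof. by move=> i j e; rewrite e normc_conjc. Qed.

(* [O : zO] <= C |N z| by packing: the elements x z + r k, for x in a large cube,
   are distinct, so with more residues than that the pigeonhole principle would
   give a nonzero integral element of norm less than 1. *)
Lemma index_bound : exists2 C : R, 0 < C & forall (z : F) (K : finType) (r : K -> F),
  z != 0 -> inO z -> (forall k, inO (r k)) ->
  (forall k k', inO ((r k - r k') / z) -> k = k') ->
  #|K|%:R <= C * \prod_i normc (sigma i z).
Proof.
have [C C1le hC] := cubept_bound.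
have [D0 surj om_int om_det om_span] := hframe.
have C0 : 0 < C by rewrite (lt_le_trans _ C1le).
(* There will be T^D #|K| points and at most (10 C T / k)^D = 2 N (10 C T)^D cells, so T cancels and
   a larger #|K| forces a collision. *)
exists (2 * (10 * C) ^+ D); first by rewrite mulr_gt0 // exprn_gt0 // mulr_gt0.
move=> z K r z0 oz orr rinj.
have nz i : 0 < normc (sigma i z) by rewrite normc_gt0 // fmorph_eq0.
set N := \prod_i _; have N0 : 0 < N by rewrite prodr_gt0.
(* Cells of side k |sigma z|: two points of one cell differ by an element of norm at most k^D N =
   1/2. *)
have [k k0 kD] : exists2 k : R, 0 < k & k ^+ D = (2 * N)^-1.
  by apply: exists_root => //; rewrite invr_gt0 mulr_gt0.
have [T0 T00 hT0] := @exists_nat_bound R ('I_D * K)%type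
  (fun p => normc (sigma p.1 (r p.2)) / (C * normc (sigma p.1 z))).
have [T1 T10 hT1] := @exists_nat_bound R unit (fun=> k / C).
(* T >= T0 makes the residues r a no larger than the cube term C T |sigma z|; T >= T1 gives k <= C
   T, which absorbs the summand 2 of the pigeonhole bound. *)
pose T := (T0 + T1)%N.
have T0R : 0 < T%:R :> R by rewrite ltr0n addn_gt0 T00.
have [K0|K0] := posnP #|K|.
  by rewrite K0 mulr_ge0 ?ltW // mulr_gt0 // exprn_gt0 // mulr_gt0.
rewrite leNgt; apply/negP => hlt.
pose f (p : {ffun 'I_D -> 'I_T} * K) := cubept p.1 * z + r p.2.
have finj : injective f.
  move=> [x a] [x' a']; rewrite {}/f /= => e.
  have e1 : (r a - r a') / z = cubept x' - cubept x.
    apply: (mulIf z0); rewrite divfK // mulrBl.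
    have -> : r a = cubept x' * z + r a' - cubept x * z by rewrite -e addrC addKr.
    ring.
  have ea : a = a' by apply: rinj; rewrite e1; apply: inOB; exact: inO_cubept.
  move: e1; rewrite ea subrr mul0r => /esym/eqP; rewrite subr_eq0 => /eqP.
  by move/cubept_inj => ->.
have cardI : #|{: {ffun 'I_D -> 'I_T} * K}|%:R = T%:R ^+ D * #|K|%:R :> R.
  by rewrite card_prod card_ffun !card_ord natrM natrX.
have [|||||p [p' [pp' _ hp]]] := @pigeonhole F R D sigma om hframe _ unit f (fun=> tt)
  (fun i => 2 * C * T%:R * normc (sigma i z)) (fun i => k * normc (sigma i z)).
- by move=> i; rewrite mulr_gt0.
- exact: conj_invariant_normc.
- move=> [x a] i; rewrite /f rmorphD rmorphM /= (le_trans (normcD_le _ _)) //.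
  rewrite ComplexField.Normc.normcM.
  have h1 := hC T x i; have := hT0 (i, a) => /=.
  rewrite ler_pdivrMr ?mulr_gt0 // => h2.
  have h3 : normc (sigma i (cubept x)) * normc (sigma i z) <= C * T%:R * normc (sigma i z).
    by rewrite ler_wpM2r ?normc_ge0.
  have h4 : T0%:R * (C * normc (sigma i z)) <= T%:R * (C * normc (sigma i z)).
    by rewrite ler_wpM2r ?ler_nat ?leq_addr // mulr_ge0 // ltW.
  have -> : 2 * C * T%:R * normc (sigma i z) =
    C * T%:R * normc (sigma i z) + T%:R * (C * normc (sigma i z)) by ring.
  by apply: lerD => //; exact: le_trans h2 h4.
- by rewrite card_prod card_ffun !card_ord muln_gt0 K0 expn_gt0 addn_gt0 T00.
- rewrite card_unit mul1r cardI.
  have kC : k <= C * T%:R.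
    have := hT1 tt; rewrite ler_pdivrMr // mulrC => h; rewrite (le_trans h) //.
    by rewrite ler_wpM2l ?ler_nat ?leq_addl // ltW.
  apply: (@le_lt_trans _ _ ((10 * C * T%:R / k) ^+ D)).
    rewrite -[D in leRHS]card_ord -prodr_const; apply: ler_prod => i _.
    have -> : 4 * (2 * C * T%:R * normc (sigma i z)) / (k * normc (sigma i z))
      = 8 * C * T%:R / k.
      have := nz i; set n := normc _ => n0; field.
      by rewrite !gt_eqF.
    have q1 : 1 <= C * T%:R / k by rewrite ler_pdivlMr ?mul1r.
    have -> : 8 * C * T%:R / k = 8 * (C * T%:R / k) by ring.
    have -> : 10 * C * T%:R / k = 8 * (C * T%:R / k) + 2 * (C * T%:R / k) by ring.
    apply/andP; split; first by rewrite addr_ge0 // mulr_ge0 // (le_trans ler01).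
    by apply: lerD => //; rewrite ler_peMr.
  rewrite exprMn exprVn kD invrK exprMn.
  have := hlt; rewrite -(ltr_pM2l (exprn_gt0 D T0R)).
  by apply: le_lt_trans; rewrite le_eqVlt; apply/orP; left; apply/eqP; ring.
have y0 : f p - f p' != 0 by rewrite subr_eq0; apply: contra pp' => /eqP/finj ->.
have oy : inO (f p - f p').
  by apply: inOB; apply: inOD => //; apply: inOM => //; exact: inO_cubept.
have := norm_ge1 hframe oy y0; apply/negP; rewrite -ltNge.
apply: (@le_lt_trans _ _ (\prod_i (k * normc (sigma i z)))).
  by apply: ler_prod => i _; rewrite normc_ge0 hp.
rewrite big_split /= prodr_const card_ord kD -/N invfM -mulrA mulVf ?gt_eqF //.
by rewrite mulr1 invf_lt1 ?ltr1n.
Qed.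

End Index.

(** * Independence of the places and the Chinese remainder theorem *)

Section Separation.
Variable F : fieldExtType rat.
Implicit Types (w : F -> int) (x : F).

Lemma vge_is_ord0 w x : is_ord w -> vge w 0 x = (0 <= w x).
Proof.
move=> hw; rewrite /vge; have [->|//] := eqVneq x 0.
by rewrite ord_zero ?lexx.
Qed.

Lemma cong_mE w x y : is_ord w -> cong_m w x y <-> vge w 1 (x - y).
Proof.
move=> hw; rewrite /cong_m /vge subr_eq0; split.
  by case=> [->|h]; rewrite ?eqxx //; apply/orP; right; rewrite -gtz0_ge1.
by case/orP => [/eqP|h]; [left|right; rewrite gtz0_ge1].
Qed.

(** Elements with w = 0 have w' = 0, since both they and their inverses are w'-integral. So w' =
    w'(t) w for a uniformizer t of w, and as w' takes the value 1 the nonnegative factor w'(t) is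
    1. *)
Lemma ord_subset w w' : is_ord w -> is_ord w' ->
  (forall x, vge w 0 x -> vge w' 0 x) -> w = w'.
Proof.
move=> hw hw' sub.
have [t [t0 wt]] : exists t, t != 0 /\ w t = 1 by case: hw => _ [_ [_]].
have wXz v (k : int) z : is_ord v -> z != 0 -> v (z ^ k) = v z * k.
  move=> hv z0; case: k => n; first by rewrite -exprnP ordX.
  by rewrite NegzE -exprnN ordV ?expf_neq0 // ordX // mulrN.
have unit0 u : u != 0 -> w u = 0 -> w' u = 0.
  move=> u0 wu; have := sub u; rewrite !vgeE // wu => /(_ isT) h1.
  have := sub u^-1; rewrite !vgeE ?invr_neq0 // !ordV // wu oppr0 => /(_ isT).
  lia.
have key x : x != 0 -> w' x = w x * w' t.
  move=> x0; have tz : t ^ (- w x) != 0 by rewrite expfz_neq0.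
  have := unit0 (x * t ^ (- w x)); rewrite mulf_neq0 // !ordM // !wXz // wt.
  by move=> /(_ isT); lia.
have [y [y0 wy]] : exists y, y != 0 /\ w' y = 1 by case: hw' => _ [_ [_]].
have et : w' t = 1.
  have h1 := key _ y0; have := sub t; rewrite !vgeE // wt => /(_ isT) h2.
  have : (w' t %| 1)%Z by apply/dvdzP; exists (w y); rewrite -h1 wy.
  by rewrite dvdz1 => /eqP; lia.
apply/funext => x; have [->|x0] := eqVneq x 0; first by rewrite !ord_zero.
by rewrite key // et mulr1.
Qed.

(** Take x integral at w but not at w'. Its denominator s at w is a unit at w, and since s x is
    integral, s must cancel the pole of x at w'. *)
Lemma separation w w' : is_ord w -> is_ord w' -> w != w' ->
  exists b, [/\ inO b, b != 0, w b = 0 & vge w' 1 b].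
Proof.
move=> hw hw' ww'.
have [x [hx nx]] : exists x, vge w 0 x /\ ~~ vge w' 0 x.
  apply: contrapT => h; move/eqP: ww'; apply; apply: ord_subset => // x hx.
  by apply/negPn/negP => nx; apply: h; exists x.
have x0 : x != 0 by apply: contraNneq nx => ->; exact: vge0.
have [s [os osx s0 ws]] := denominator hw hx.
exists s; split=> //; have := osx _ hw'.
rewrite vgeE ?mulf_neq0 // ordM //; move: nx; rewrite !vgeE //; lia.
Qed.

Lemma separation_seq w (s : seq (F -> int)) (m : nat) : is_ord w ->
  (forall w', w' \in s -> is_ord w') -> w \notin s ->
  exists b, [/\ inO b, b != 0, w b = 0 & forall w', w' \in s -> vge w' m b].
Proof.
move=> hw; elim: s => [|v s IH] hs.
  by exists 1; rewrite oner_neq0 ord_one //; split=> //; exact: inO1.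
rewrite inE negb_or => /andP[wv ws].
have [|//|b [ob b0 wb bs]] := IH; first by move=> w' h; apply: hs; rewrite inE h orbT.
have hv : is_ord v by apply: hs; rewrite inE eqxx.
have [c [oc c0 wc vc]] := separation hw hv wv.
exists (c ^+ m * b); split.
- exact/inOM/ob/inOX.
- by rewrite mulf_neq0 ?expf_neq0.
- by rewrite ordM ?expf_neq0 // ordX // wc mul0r add0r.
move=> w'; rewrite inE => /orP[/eqP ->|w's].
  have vb := ob v hv; apply: vgeM0 => //.
  rewrite vgeE ?expf_neq0 // (ordX hv) //.
  by move: vc; rewrite vgeE // => h; rewrite ler_peMl.
have hw' : is_ord w' by apply: hs; rewrite inE w's orbT.
rewrite mulrC vgeM0 ?bs //; exact: (inOX m oc).
Qed.

Definition residue_system w (m : nat) (K : finType) (r : K -> F) :=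
  (forall k, vge w 0 (r k)) /\ forall k k', vge w m (r k - r k') -> k = k'.

(** Multiplying all representatives by one common denominator that is a unit at w keeps them
    incongruent. *)
Lemma residue_system_inO w m (K : finType) (r : K -> F) : is_ord w ->
  residue_system w m r ->
  exists r' : K -> F, (forall k, inO (r' k)) /\ residue_system w m r'.
Proof.
move=> hw [r0 rinj].
have [s sP] := choice (fun k => denominator hw (r0 k)).
pose t := \prod_k s k.
have t0 : t != 0 by apply/prodf_neq0 => k _; case: (sP k).
have wt : w t = 0.
  rewrite ord_prod //; last by move=> k _; case: (sP k).
  by rewrite big1 // => k _; case: (sP k).
exists (fun k => t * r k).
have ot k : inO (t * r k).
  rewrite /t (bigD1 k) //= mulrAC; apply: inOM; first by case: (sP k).
  by apply: inO_prod => k' _; case: (sP k').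
split=> //; split=> [k|k k']; first exact: ot.
by rewrite -mulrBr vge_unitM //; exact: rinj.
Qed.

(** In b * r a + r' a' the factor b is a unit at w and highly divisible at the other places: those
    places see only a', and once the a' agree, w sees only a. *)
Lemma chinese_remainder (s : seq (F -> int)) (m k : (F -> int) -> nat) : uniq s ->
  (forall w, w \in s -> is_ord w) ->
  (forall w, w \in s -> exists (K : finType) (r : K -> F),
     #|K| = k w /\ residue_system w (m w) r) ->
  exists (K : finType) (r : K -> F), [/\ #|K| = (\prod_(w <- s) k w)%N,
    (forall i, inO (r i)) &
    forall i j, (forall w, w \in s -> vge w (m w) (r i - r j)) -> i = j].
Proof.
elim: s => [|w s IH] us hs hres.
  exists unit, (fun=> 0); split; first by rewrite card_unit big_nil.
    by move=> _; exact: inO0.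
  by move=> [] [].
move: us; rewrite cons_uniq => /andP[ws us].
have hs' v : v \in s -> is_ord v by move=> h; apply: hs; rewrite inE h orbT.
have [|||K' [r' [cK' or' rinj']]] := IH => //.
  by move=> v h; apply: hres; rewrite inE h orbT.
have hw : is_ord w by apply: hs; rewrite inE eqxx.
have [K [r0 [cK hr0]]] := hres w (mem_head _ _).
have [r [or [_ rinj]]] := residue_system_inO hw hr0.
have [b [ob b0 wb bs]] := separation_seq (\max_(v <- s) m v) hw hs' ws.
exists (K * K')%type, (fun p => b * r p.1 + r' p.2); split.
- by rewrite card_prod cK cK' big_cons.
- by move=> p; apply: inOD => //; exact: inOM.
move=> [a a'] [c c'] /= h.
have e : b * r a + r' a' - (b * r c + r' c') = b * (r a - r c) + (r' a' - r' c').
  by ring.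
have ea : a' = c'.
  apply: rinj' => v vs; have hv := hs' v vs.
  have := h v; rewrite inE vs orbT e => /(_ isT) h1.
  have -> : r' a' - r' c' = (b * (r a - r c) + (r' a' - r' c')) - b * (r a - r c) by ring.
  rewrite vgeB // vgeM0 ?vgeB ?or //.
  apply: vgeW (bs v vs) => //.
  by rewrite lez_nat (big_rem v) //= leq_maxl.
have := h w; rewrite mem_head e ea subrr addr0 vge_unitM // => /(_ isT) /rinj ->.
by [].
Qed.

End Separation.

Lemma exists_max_nat (P : nat -> Prop) n : P 0%N -> (forall k, P k -> (k <= n)%N) ->
  exists k, P k /\ ~ P k.+1.
Proof.
move=> P0 Pn; have ex : exists k, `[< P k >] by exists 0%N; apply/asboolP.
have bd k : `[< P k >] -> (k <= n)%N by move/asboolP; exact: Pn.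
case: (ex_maxnP ex bd) => k /asboolP Pk kmax; exists k; split=> // Pk1.
by have := kmax k.+1; rewrite ltnn => h; have := h (asboolT Pk1).
Qed.

Lemma enumerate_bounded (T : eqType) (P : T -> Prop) n :
  (forall s : seq T, uniq s -> (forall x, x \in s -> P x) -> (size s <= n)%N) ->
  exists s : seq T, uniq s /\ forall x, x \in s <-> P x.
Proof.
move=> h.
pose Q k := exists s : seq T, [/\ uniq s, forall x, x \in s -> P x & size s = k].
have [||k [[s [us sP sk]] nQ]] := @exists_max_nat Q n.
- by exists [::].
- by move=> k [s [us sP <-]]; exact: h.
exists s; split=> // x; split; first exact: sP.
move=> Px; apply/negPn/negP => xs; apply: nQ; exists (x :: s); split.
- by rewrite /= xs us.
- by move=> y; rewrite inE => /orP[/eqP ->|]; [|exact: sP].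
by rewrite /= sk.
Qed.

(** * Finiteness of residue fields and supports *)

Section Places.
Variables (F : fieldExtType rat) (R : realType) (D : nat).
Variables (sigma : 'I_D -> {rmorphism F -> R[i]}) (om : 'I_D -> F).
Hypothesis hframe : integral_frame sigma om.
Implicit Types (w : F -> int) (x : F).

(** The maximal ideal contains a positive integer m, so integral elements incongruent at w are
    incongruent modulo m O, and [index_bound] applies to z = m. *)
Lemma residue_system_bounded w : is_ord w -> exists n, forall (K : finType) (r : K -> F),
  residue_system w 1 r -> (#|K| <= n)%N.
Proof.
move=> hw; have [C C0 hC] := index_bound hframe.
have [m [m1 hm _]] := int_in_ideal hw.
have m0 : m%:R != 0 :> F by rewrite natF_eq0; lia.
exists (Num.truncn (C * \prod_i normc (sigma i m%:R))) => K r hr.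
have [r' [or' [_ r'inj]]] := residue_system_inO hw hr.
rewrite truncn_ge_nat; last first.
  by rewrite mulr_ge0 ?(ltW C0) // prodr_ge0 // => i _; exact: normc_ge0.
apply: (hC m%:R K r') => //; first exact: inO_nat.
move=> k k' h; apply: r'inj; rewrite -(divfK m0 (_ - _)) mulrC.
by apply: vgeM0 => //; exact: h.
Qed.

(** An incongruent system of maximal size is complete: an element congruent to none of its members
    could be adjoined. *)
Lemma residue_card_exists w : is_ord w -> exists q, residue_card w q.
Proof.
move=> hw; have [n hn] := residue_system_bounded hw.
pose P q := exists r : 'I_q -> F, residue_system w 1 r.
have [||q [[s [s0 sinj]] nP]] := @exists_max_nat P n.
- by exists (fun=> 0); split=> [k|[]//]; exact: vge0.
- by move=> k [r hr]; have := hn _ r hr; rewrite card_ord.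
exists q, s; split; first by move=> k; rewrite -vge_is_ord0.
split; first by move=> k k' /cong_mE h; apply: sinj; exact: h.
move=> x hx; apply: contrapT => nx; apply: nP.
exists (fun k => if unlift ord_max k is Some j then s j else x); split.
  by move=> k; case: unliftP => [j|] _; [|rewrite vge_is_ord0].
move=> k k'; case: unliftP => [j ->|->]; case: unliftP => [j' ->|->] //.
- by move/sinj => ->.
- move=> h; exfalso; apply: nx; exists j; apply/cong_mE => //.
  by rewrite -opprB vgeN.
- by move=> h; exfalso; apply: nx; exists j'; apply/cong_mE.
Qed.

Lemma qvP w : is_ord w -> residue_card w (qv w).
Proof.
move=> hw; rewrite /qv; case: xgetP => [q _ //|h].
by have [q hq] := residue_card_exists hw; case: (h q).
Qed.

(** The integers 0, ..., p-1 are incongruent at w, hence p <= q_w. Denominators will be built from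
    these p, so that their size is controlled by the q_w. *)
Lemma small_prime_element w : is_ord w ->
  exists p : nat, [/\ (1 < p)%N, (p <= qv w)%N & vge w 1 p%:R].
Proof.
move=> hw; have [p [p1 hp pmin]] := int_in_ideal hw; exists p; split=> //.
have [s [s0 [sinj sall]]] := qvP hw.
have ex (i : 'I_p) : exists k, cong_m w i%:R (s k).
  by apply: sall; rewrite -vge_is_ord0 // vge_nat.
have [f fP] := choice ex.
rewrite -(card_ord p) -(card_ord (qv w)); apply: (leq_card f).
move=> i j e; apply/val_inj => /=.
have h : vge w 1 (i%:R - j%:R).
  have /cong_mE h1 := fP i; have /cong_mE h2 := fP j.
  have -> : i%:R - j%:R = (i%:R - s (f i)) - (j%:R - s (f j)) by rewrite e; ring.
  by apply: vgeB => //; [exact: h1|exact: h2].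
have : (p %| (i%:Z - j%:Z))%Z by apply: pmin; rewrite intrB.
case: (i) (j) => a ha [b hb] /=; clear -ha hb.
move=> /dvdzP[c ec].
have : c = 0 by nia.
by move=> c0; move: ec; rewrite c0 mul0r; lia.
Qed.

Lemma qv_gt1 w : is_ord w -> (1 < qv w)%N.
Proof. by case/small_prime_element => p [p1 pq _]; exact: leq_trans pq. Qed.

Lemma residue_system_pow w m : is_ord w ->
  exists (K : finType) (r : K -> F), #|K| = (qv w ^ m)%N /\ residue_system w m r.
Proof.
move=> hw; have [s [s0 [sinj _]]] := qvP hw.
have [t [t0 wt]] : exists t, t != 0 /\ w t = 1 by case: hw => _ [_ [_]].
have vt : vge w 1 t by rewrite vgeE // wt.
have vtV : vge w (-1) t^-1 by rewrite vgeE ?invr_eq0 // ordV // wt.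
elim: m => [|m [K [r [cK [r0 rinj]]]]].
  exists unit, (fun=> 0); rewrite card_unit; split=> //; split=> [_|[] []//].
  exact: vge0.
exists ('I_(qv w) * K)%type, (fun p => s p.1 + t * r p.2).
rewrite card_prod card_ord cK expnS; split=> //; split=> [[k k'] /=|].
  apply: vgeD => //; first by rewrite vge_is_ord0.
  by rewrite mulrC vgeM0 // (vgeW (m' := 1)).
move=> [k l] [k' l'] /= h.
have e : s k + t * r l - (s k' + t * r l') = (s k - s k') + t * (r l - r l') by ring.
have htr : vge w 1 (t * (r l - r l')) by rewrite vgeM0 // vgeB.
have ek : k = k'.
  apply: sinj; apply/cong_mE => //.
  have -> : s k - s k' = (s k + t * r l - (s k' + t * r l')) - t * (r l - r l') by ring.
  by apply: vgeB => //; apply: vgeW h; lia.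
move: h; rewrite e ek subrr add0r => h; rewrite (rinj l l') //.
have -> : r l - r l' = t^-1 * (t * (r l - r l')) by rewrite mulKf.
have -> : m%:Z = -1 + m.+1%:Z by lia.
exact: vgeM.
Qed.

(** The label lists the first m digits of x in the expansion along the uniformizer t. Where
    [residue_system_pow] bounds the number of classes from below, this bounds it from above. *)
Lemma residue_labels w m : is_ord w ->
  exists (L : finType) (lab : F -> L), #|L| = (qv w ^ m)%N /\
    forall x y, vge w 0 x -> vge w 0 y -> lab x = lab y -> vge w m (x - y).
Proof.
move=> hw; have [s [s0 [sinj sall]]] := qvP hw.
have [t [t0 wt]] : exists t, t != 0 /\ w t = 1 by case: hw => _ [_ [_]].
have vt : vge w 1 t by rewrite vgeE // wt.
have vtV : vge w (-1) t^-1 by rewrite vgeE ?invr_eq0 // ordV // wt.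
have ex x : exists k, vge w 0 x -> cong_m w x (s k).
  have [hx|hx] := boolP (vge w 0 x).
    by have [k hk] := sall x (etrans (esym (vge_is_ord0 _ hw)) hx); exists k.
  by have q1 := qv_gt1 hw; exists (Ordinal (ltnW q1)).
have [dig digP] := choice ex.
elim: m => [|m [L [lab [cL labP]]]].
  by exists unit, (fun=> tt); rewrite card_unit; split=> // x y hx hy _; exact: vgeB.
exists ('I_(qv w) * L)%type, (fun x => (dig x, lab (t^-1 * (x - s (dig x))))).
rewrite card_prod card_ord cL expnS; split=> // x y hx hy [ed el].
have h0 z : vge w 0 z -> vge w 0 (t^-1 * (z - s (dig z))).
  move=> hz; have /cong_mE h := digP z hz.
  by have -> : (0 : int) = -1 + 1 by []; apply: vgeM => //; exact: h.
have := labP _ _ (h0 _ hx) (h0 _ hy) el.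
rewrite -mulrBr => h.
have -> : x - y = t * (t^-1 * (x - s (dig x) - (y - s (dig y)))).
  by rewrite mulVKf // ed; ring.
have -> : (m.+1 : int) = 1 + m%:Z by lia.
exact: vgeM.
Qed.

Lemma labels_seq (s : seq (F -> int)) (m : (F -> int) -> nat) :
  (forall w, w \in s -> is_ord w) ->
  exists (L : finType) (lab : F -> L), #|L| = (\prod_(w <- s) qv w ^ m w)%N /\
    forall x y, inO x -> inO y -> lab x = lab y ->
      forall w, w \in s -> vge w (m w) (x - y).
Proof.
elim: s => [|w s IH] hs.
  by exists unit, (fun=> tt); rewrite card_unit big_nil.
have [|L [lab [cL hL]]] := IH; first by move=> v vs; apply: hs; rewrite inE vs orbT.
have hw : is_ord w by apply: hs; rewrite mem_head.
have [L' [lab' [cL' hL']]] := residue_labels (m w) hw.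
exists (L' * L)%type, (fun x => (lab' x, lab x)).
rewrite card_prod cL cL' big_cons; split=> // x y ox oy [e1 e2] v.
rewrite inE => /orP[/eqP ->|vs]; first by apply: hL' => //; [exact: ox|exact: oy].
exact: hL.
Qed.

(* One half of the product formula, up to a constant. *)
Lemma norm_lower_bound : exists2 C : R, 0 < C & forall (z : F) (s : seq (F -> int)),
  z != 0 -> inO z -> uniq s -> (forall w, w \in s -> is_ord w) ->
  (\prod_(w <- s) qv w ^ `|w z|)%:R <= C * \prod_i normc (sigma i z).
Proof.
have [C C0 hC] := index_bound hframe; exists C => // z s z0 oz us hs.
have [K [r [cK or rinj]]] :=
  @chinese_remainder F s (fun w => `|w z|%N) (fun w => (qv w ^ `|w z|)%N) us hs
    (fun w ws => residue_system_pow _ (hs w ws)).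
rewrite -cK; apply: hC => // k k' h; apply: rinj => w ws; have hw := hs w ws.
have wz : 0 <= w z by rewrite -vge_is_ord0 //; exact: oz.
have -> : (`|w z|%N : int) = 0 + w z by lia.
rewrite -[r k - r k'](divfK z0); apply: vgeM => //; first exact: h.
by rewrite vgeE.
Qed.

(** Each such place contributes a factor of at least 2 to the product in [norm_lower_bound], so
    their number is bounded. *)
Lemma positive_places z : z != 0 -> inO z ->
  exists s : seq (F -> int), uniq s /\ forall w, w \in s <-> (is_ord w /\ 0 < w z).
Proof.
move=> z0 oz; have [C C0 hC] := norm_lower_bound.
apply: (@enumerate_bounded _ _ (Num.truncn (C * \prod_i normc (sigma i z)))).
move=> s us hs.
have B0 : 0 <= C * \prod_i normc (sigma i z).
  by rewrite mulr_ge0 ?(ltW C0) // prodr_ge0 // => i _; exact: normc_ge0.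
rewrite truncn_ge_nat //; apply: le_trans (hC z s z0 oz us _); last by move=> w /hs[].
rewrite ler_nat.
elim: s {us} hs => // w s IH hs; rewrite big_cons /=.
have [hw wz] := hs w (mem_head _ _).
have h1 := IH (fun v vs => hs v (mem_behead (s := w :: s) vs)).
have h2 : (2 <= qv w ^ `|w z|)%N.
  have q1 := qv_gt1 hw; have : (0 < `|w z|)%N by lia.
  case: `|w z|%N => // e _; rewrite expnS.
  by rewrite -[2%N]muln1 leq_mul // expn_gt0 (ltnW q1).
have h3 : (0 < \prod_(v <- s) qv v ^ `|v z|)%N.
  rewrite big_seq prodn_cond_gt0 // => v vs; rewrite expn_gt0.
  by have [hv _] := hs v (mem_behead (s := w :: s) vs); rewrite (ltnW (qv_gt1 hv)).
apply: leq_trans (leq_mul h2 (leqnn _)).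
by rewrite mul2n -addnn -addn1 addnC leq_add.
Qed.

Lemma support_finite x : x != 0 -> exists s : seq (F -> int), uniq s /\
  forall w, w \in s <-> (is_ord w /\ w x != 0).
Proof.
move=> x0; have [m m0 om1] := inO_multiple x.
have mF : m%:~R != 0 :> F by rewrite intF_eq0.
(* The second factor m makes the product positive also at the poles of x: there w m >= - w x > 0. *)
have z0 : m%:~R * (m%:~R * x) != 0 by rewrite !mulf_neq0.
have oz : inO (m%:~R * (m%:~R * x)) by apply: inOM => //; exact: inO_int.
have [s [us sP]] := positive_places z0 oz.
exists [seq w <- s | w x != 0]; rewrite filter_uniq //; split=> // w.
rewrite mem_filter; split; first by case/andP=> -> /sP[].
move=> [hw wx]; rewrite wx /=; apply/sP; split=> //.
have h1 : 0 <= w m%:~R by rewrite -vge_is_ord0 //; exact: vge_int.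
have h2 : 0 <= w (m%:~R * x) by rewrite -vge_is_ord0 //; exact: om1.
by move: h2; rewrite !ordM ?mulf_neq0 //; lia.
Qed.

End Places.

(** * Small representatives modulo n-th powers *)

Lemma prod_subset_leq (T : eqType) (s t : seq T) (q : T -> nat) : uniq t ->
  {subset t <= s} -> (forall x, x \in s -> (0 < q x)%N) ->
  (\prod_(x <- t) q x <= \prod_(x <- s) q x)%N.
Proof.
elim: t s => [|x t IH] s; first by move=> _ _ q0; rewrite big_nil big_seq prodn_cond_gt0.
rewrite cons_uniq => /andP[xt ut] ts q0; have xs : x \in s by apply: ts; rewrite mem_head.
rewrite big_cons (big_rem x xs) /= leq_pmul2l ?q0 //.
apply: IH => // [y yt|y yr]; last by apply: q0; exact: mem_rem yr.
have ys : y \in s by apply: ts; rewrite inE yt orbT.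
have := perm_to_rem xs => /perm_mem/(_ y); rewrite ys inE => /esym/orP[/eqP e|//].
by move: xt; rewrite -e yt.
Qed.

Lemma leq_ceil_mul a n : (0 < n)%N -> (a <= (a + n.-1) %/ n * n)%N.
Proof.
move=> n0; have := divn_eq (a + n.-1) n; have := ltn_pmod (a + n.-1) n0.
by move: (_ %/ _)%N (_ %% _)%N => p q; rewrite -[in X in X -> _](prednK n0); lia.
Qed.

Section Representative.
Variables (F : fieldExtType rat) (R : realType) (D : nat).
Variables (sigma : 'I_D -> {rmorphism F -> R[i]}) (om : 'I_D -> F).
Hypothesis hframe : integral_frame sigma om.
Implicit Types (w : F -> int) (x : F).

(** A form of Minkowski's theorem: the pigeonhole principle on cube points, with their residues as
    labels. *)
Lemma exists_small_element : exists2 C : R, 0 < C &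
  forall (s : seq (F -> int)) (m : (F -> int) -> nat) (d : 'I_D -> R),
  (forall w, w \in s -> is_ord w) -> conj_invariant sigma d ->
  (forall i, 0 < d i) ->
  (\prod_(w <- s) qv w ^ m w)%:R * C ^+ D < \prod_i d i ->
  exists c, [/\ c != 0, inO c, forall w, w \in s -> vge w (m w) c &
    forall i, normc (sigma i c) <= d i].
Proof.
have [C C1 hC] := cubept_bound sigma om.
have C0 : 0 < C by rewrite (lt_le_trans ltr01).
(* The conjugates of cube points are at most C T. For T >= d i / C the cell count 4 C T / d i + 2 is
   at most 6 C T / d i, and T^D points suffice whatever T is. *)
exists (6 * C); first by rewrite mulr_gt0.
move=> s m d hs dinv d0 hlt.
have [L [lab [cL labP]]] := labels_seq hframe m hs.
have [T T0 hT] := @exists_nat_bound R 'I_D (fun i => d i / C).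
have TR : 0 < T%:R :> R by rewrite ltr0n.
have dT i : d i <= C * T%:R by rewrite mulrC -ler_pdivrMr.
have [|||k [k' [kk lk hk]]] := @pigeonhole F R D sigma om hframe _ L (@cubept F D om T)
  (fun k => lab (cubept om k)) (fun=> C * T%:R) d d0 dinv.
- by move=> k i; exact: hC.
- by rewrite card_ffun !card_ord expn_gt0 T0.
- rewrite cL card_ffun !card_ord natrX.
  apply: (@le_lt_trans _ _ ((\prod_(w <- s) qv w ^ m w)%:R * \prod_i (6 * C * T%:R / d i))).
    rewrite ler_wpM2l //; apply: ler_prod => i _.
    have q1 : 1 <= C * T%:R / d i by rewrite ler_pdivlMr ?mul1r.
    have -> : 4 * (C * T%:R) / d i = 4 * (C * T%:R / d i) by ring.
    have -> : 6 * C * T%:R / d i = 4 * (C * T%:R / d i) + 2 * (C * T%:R / d i) by ring.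
    apply/andP; split; first by rewrite addr_ge0 // mulr_ge0 // (le_trans ler01).
    by apply: lerD => //; rewrite ler_peMr.
  rewrite big_split /= prodfV prodr_const card_ord mulrA ltr_pdivrMr ?prodr_gt0 //.
  by rewrite exprMn mulrA [ltRHS]mulrC ltr_pM2r ?exprn_gt0.
exists (cubept om k - cubept om k'); split=> //.
- by rewrite subr_eq0; apply: contra kk => /eqP/(cubept_inj hframe)->.
- by apply: inOB; exact: (inO_cubept hframe).
- by apply: labP => //; exact: (inO_cubept hframe).
Qed.

(* With z = m^n / u integral, one looks for a nonzero integral c such that
   n w(c) >= w(z) at every w and |sigma c| <= la |sigma z|^(1/n): then
   u (c/m)^n = c^n / z is integral with conjugates at most la^n.  This replaces
   the finiteness of the class group and of the units modulo n-th powers. *)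
Lemma bounded_representative : exists2 C : R, 1 <= C &
  forall (n : nat) (u : F) (s : seq (F -> int)), (0 < n)%N -> u != 0 ->
  uniq s -> (forall w, w \in s -> is_ord w) ->
  (forall w, is_ord w -> ~~ (n %| w u)%Z -> w \in s) ->
  exists c, [/\ c != 0, inO (u * c ^+ n) &
    forall i, normc (sigma i (u * c ^+ n)) <= (C * (\prod_(w <- s) qv w)%:R) ^+ n].
Proof.
have [A A0 hA] := exists_small_element.
have [Cl Cl0 hCl] := norm_lower_bound hframe.
have D0 : (0 < D)%N by case: hframe.
exists ((A + 1) * (Cl + 1)).
  by rewrite mulr_ege1 // lerDr ltW.
move=> n u s n0 u0 us hs hsup.
set M := (\prod_(w <- s) qv w)%N.
have M1 : (0 < M)%N.
  by rewrite /M big_seq prodn_cond_gt0 // => w /hs hw; rewrite ltnW // (qv_gt1 hframe hw).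
have M1R : 1 <= M%:R :> R by rewrite ler1n.
have [m m0 om1] := inO_multiple u^-1.
have mF : m%:~R != 0 :> F by rewrite intF_eq0.
pose z : F := m%:~R ^+ n / u.
have z0 : z != 0 by rewrite mulf_neq0 ?expf_neq0 ?invr_eq0.
have oz : inO z.
  rewrite /z -(prednK n0) exprSr -mulrA; apply: inOM => //.
  by apply: inOX; exact: inO_int.
have wz w : is_ord w -> w z = n%:Z * w m%:~R - w u.
  by move=> hw; rewrite ordM ?expf_neq0 ?invr_eq0 // ordX // ordV // mulrC.
have [t [ut tP]] := positive_places hframe z0 oz.
(* The order required of c: w z / n rounded up. Rounding costs at most the factor g w^n, and nothing
   when n divides w z. *)
pose e w := ((`|w z| + n.-1) %/ n)%N.
pose g w := (if (n %| w z)%Z then 1 else qv w)%N.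
have q1 w : w \in t -> (1 < qv w)%N by case/tP => hw _; exact: (qv_gt1 hframe hw).
have step w : w \in t -> ((qv w ^ e w) ^ n <= qv w ^ `|w z| * g w ^ n)%N.
  move=> wt; rewrite -expnM /g; case: ifPn => h.
    rewrite exp1n muln1 leq_pexp2l ?(ltnW (q1 _ wt)) //.
    have /dvdnP[k hk] : (n %| `|w z|)%N by exact: h.
    by rewrite /e hk divnMDl // divn_small ?addn0 // ltn_predL n0.
  rewrite -expnD leq_pexp2l ?(ltnW (q1 _ wt)) //.
  rewrite (leq_trans (leq_divM _ _)) // leq_add2l; exact: leq_pred.
(* Since w z = n w(m) - w u, rounding occurs only where n does not divide w u, and these places are
   in s. *)
have gM : (\prod_(w <- t) g w <= M)%N.
  rewrite /g (eq_bigr (fun w => if ~~ (n %| w z)%Z then qv w else 1%N)); last first.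
    by move=> w _; case: ifP.
  rewrite -big_mkcond /= -big_filter; apply: prod_subset_leq.
  - by rewrite filter_uniq.
  - move=> w; rewrite mem_filter => /andP[nw /tP[hw _]]; apply: hsup => //.
    apply: contra nw => nu; rewrite wz //; apply: rpredB => //.
    exact: dvdz_mulr.
  - by move=> w /hs hw; rewrite ltnW // (qv_gt1 hframe hw).
pose Q := (\prod_(w <- t) qv w ^ e w)%N.
set N := \prod_i normc (sigma i z).
have nz i : 0 < normc (sigma i z) by rewrite normc_gt0 // fmorph_eq0.
have N0 : 0 < N by rewrite prodr_gt0.
have prodX (f : (F -> int) -> nat) :
    ((\prod_(w <- t) f w) ^ n = \prod_(w <- t) f w ^ n)%N.
  exact: (big_morph (fun a : nat => (a ^ n)%N) (fun a b : nat => expnMn a b n) (exp1n n)).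
have QN : (Q ^ n)%:R <= Cl * N * M%:R ^+ n.
  apply: (@le_trans _ _ ((\prod_(w <- t) qv w ^ `|w z|)%N%:R * M%:R ^+ n)); last first.
    rewrite ler_wpM2r ?exprn_ge0 //; apply: hCl => // w /tP[] //.
  rewrite -natrX -natrM ler_nat.
  apply: (@leq_trans (\prod_(w <- t) (qv w ^ `|w z| * g w ^ n))).
    by rewrite /Q prodX big_seq [leqRHS]big_seq; apply: leq_prod => w; exact: step.
  by rewrite big_split /= leq_mul2l -prodX leq_exp2r // gM orbT.
(* A comes from [exists_small_element], Cl and M from the bound on Q^n. Adding 1 lets the constants
   be raised to larger powers and makes the inequality strict; it is checked on n-th powers, where
   the roots [rho] disappear. *)
pose la := (A + 1) * (Cl + 1) * M%:R.
have la0 : 0 < la by rewrite !mulr_gt0 ?addr_gt0 // (lt_le_trans ltr01).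
pose rho i := normc (sigma i z) `^ n%:R^-1.
have rhoP i : rho i ^+ n = normc (sigma i z).
  rewrite /rho -powR_mulrn ?powR_ge0 // -powRrM mulVf ?powRr1 ?normc_ge0 //.
  by rewrite pnatr_eq0 -lt0n.
have rho0 i : 0 < rho i by exact: powR_gt0.
have [|||| c [c0 oc hc hcn]] := hA t e (fun i => la * rho i).
- by move=> w /tP[].
- by move=> i j eij; rewrite /rho eij normc_conjc.
- by move=> i; rewrite mulr_gt0.
- rewrite -(ltr_pXn2r n0) ?nnegrE; last 2 first.
  + by rewrite mulr_ge0 ?exprn_ge0 // ltW.
  + by rewrite prodr_ge0 // => i _; rewrite mulr_ge0 // ltW.
  rewrite big_split /= prodr_const card_ord !exprMn -prodrXl.
  rewrite (eq_bigr (fun i => normc (sigma i z))) => [|i _]; last exact: rhoP.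
  rewrite -/N -natrX -/Q.
  apply: (@le_lt_trans _ _ (Cl * N * M%:R ^+ n * (A ^+ D) ^+ n)).
    by rewrite ler_wpM2r ?exprn_ge0 ?(ltW A0).
  have Dn : (0 < D * n)%N by rewrite muln_gt0 D0.
  have h1 : (A ^+ D) ^+ n <= ((A + 1) ^+ D) ^+ n.
    by rewrite -!exprM lerXn2r ?nnegrE ?addr_ge0 ?(ltW A0) // lerDl.
  have h2 : Cl < ((Cl + 1) ^+ D) ^+ n.
    rewrite -exprM; apply: (@lt_le_trans _ _ (Cl + 1)); first by rewrite ltrDl.
    by rewrite ler_eXnr // lerDr ltW.
  have h3 : M%:R ^+ n <= (M%:R ^+ D) ^+ n :> R.
    by rewrite -exprM ler_weXn2l // leq_pmull.
  have P1 : 0 < (A ^+ D) ^+ n by rewrite !exprn_gt0.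
  have P3 : 0 < M%:R ^+ n :> R by rewrite exprn_gt0 // (lt_le_trans ltr01).
  have -> : Cl * N * M%:R ^+ n * (A ^+ D) ^+ n = (A ^+ D) ^+ n * Cl * M%:R ^+ n * N by ring.
  rewrite ltr_pM2r //.
  apply: (@lt_le_trans _ _ ((A ^+ D) ^+ n * ((Cl + 1) ^+ D) ^+ n * M%:R ^+ n)).
    by rewrite ltr_pM2r // ltr_pM2l.
  by rewrite !ler_pM ?mulr_ge0 ?exprn_ge0 ?addr_ge0 ?(ltW A0) ?(ltW Cl0).
have mc : u * (c / m%:~R) ^+ n = c ^+ n / z.
  by rewrite /z invf_div exprMn exprVn mulrCA mulrA.
exists (c / m%:~R); rewrite mc; split.
- by rewrite mulf_neq0 ?invr_eq0.
- move=> w hw; rewrite vgeE ?mulf_neq0 ?expf_neq0 ?invr_eq0 //.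
  rewrite ord_div ?expf_neq0 // ordX // subr_ge0.
  have [wt|wt] := boolP (w \in t).
    have [_ wz0] := (tP w).1 wt; have := hc w wt; rewrite vgeE // => h.
    apply: (@le_trans _ _ (e w * n)%:Z); last by rewrite PoszM ler_wpM2r.
    by rewrite -[w z]gez0_abs ?(ltW wz0) // lez_nat leq_ceil_mul.
  have wz0 : w z <= 0 by rewrite leNgt; apply: contra wt => h; apply/tP.
  apply: le_trans wz0 _; rewrite mulr_ge0 // -vge_is_ord0 //; exact: oc.
move=> i; rewrite fmorph_div rmorphXn ComplexField.Normc.normcM normcX.
rewrite ComplexField.Normc.normcV ler_pdivrMr // -rhoP -exprMn.
rewrite -/la lerXn2r ?nnegrE ?normc_ge0 ?hcn //.
by rewrite mulr_ge0 ?(ltW la0) ?(ltW (rho0 i)).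
Qed.

End Representative.

(** Cells of side 1/2 separate integral elements, since a nonzero difference in one cell would have
    norm at most 2^-D. This gives (8 X + 2)^D <= (10 X)^D elements; one more label, for everything
    outside the list, turns 10 into 11. *)
Lemma integral_code (F : fieldExtType rat) (R : realType) (D : nat)
  (sigma : 'I_D -> {rmorphism F -> R[i]}) (om : 'I_D -> F) (X : R) :
  integral_frame sigma om -> 1 <= X ->
  exists (L : finType) (code : F -> L), #|L|%:R <= (11 * X) ^+ D /\
    forall x y, inO x -> inO y -> (forall i, normc (sigma i x) <= X) ->
      (forall i, normc (sigma i y) <= X) -> code x = code y -> x = y.
Proof.
move=> hframe X1; have D0 : (0 < D)%N by case: hframe.
have X0 : 0 < X by rewrite (lt_le_trans ltr01).
pose P x := inO x /\ forall i, normc (sigma i x) <= X.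
have bd (s : seq F) : uniq s -> (forall x, x \in s -> P x) ->
    (size s)%:R <= (10 * X) ^+ D.
  move=> us hs; rewrite leNgt; apply/negP => hlt.
  have s0 : (0 < size s)%N.
    by rewrite -(ltr_nat R); apply: lt_trans hlt; rewrite exprn_gt0 // mulr_gt0.
  have [|||||k [k' [kk _ hk]]] := @pigeonhole F R D sigma om hframe _ unit
    (fun k : 'I_(size s) => s`_k) (fun=> tt) (fun=> X) (fun=> 2^-1).
  - by move=> _; rewrite invr_gt0.
  - by [].
  - by move=> k i; have [_] := hs s`_k (mem_nth _ (ltn_ord k)).
  - by rewrite card_ord.
  - rewrite card_unit mul1r card_ord prodr_const card_ord.
    apply: le_lt_trans hlt; rewrite lerXn2r ?nnegrE ?addr_ge0 ?mulr_ge0 ?invr_ge0 ?(ltW X0) //.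
    by rewrite invrK; lra.
  have y0 : s`_k - s`_k' != 0 by rewrite subr_eq0 nth_uniq.
  have oy : inO (s`_k - s`_k').
    by apply: inOB; [have [] := hs _ (mem_nth 0 (ltn_ord k))|
      have [] := hs _ (mem_nth 0 (ltn_ord k'))].
  have := norm_ge1 hframe oy y0; apply/negP; rewrite -ltNge.
  apply: (@le_lt_trans _ _ (\prod_(i < D) 2^-1)).
    by apply: ler_prod => i _; rewrite normc_ge0 hk.
  by rewrite prodr_const card_ord exprn_ilt1 ?lt0n_neq0 ?invr_ge0 // invf_lt1 ?ltr1n.
have B0 : 0 <= (10 * X) ^+ D by rewrite exprn_ge0 // mulr_ge0 // ltW.
have [s [us sP]] : exists s : seq F, uniq s /\ forall x, x \in s <-> P x.
  apply: (@enumerate_bounded _ _ (Num.truncn ((10 * X) ^+ D))) => s us hs.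
  by rewrite truncn_ge_nat //; exact: bd.
have ind x : (index x s < (size s).+1)%N by rewrite ltnS index_size.
exists 'I_(size s).+1, (fun x => Ordinal (ind x)); split.
  rewrite card_ord -natr1; apply: (@le_trans _ _ ((10 * X) ^+ D + 1)).
    by rewrite lerD2r; apply: bd => // x /sP.
  have -> : 11 * X = 10 * X + X by ring.
  case: D D0 {bd sigma om hframe P sP B0} => // D _.
  have h1 : 1 <= X * (10 * X) ^+ D.
    by rewrite mulr_ege1 // exprn_ege1 // mulr_ege1 // ler1n.
  apply: (@le_trans _ _ ((10 * X + X) * (10 * X) ^+ D)).
    by move: (10 * X) h1 => Y h1; rewrite mulrDl exprS lerD2l.
  rewrite exprS ler_wpM2l ?addr_ge0 ?mulr_ge0 ?(ltW X0) //.
  by rewrite lerXn2r ?nnegrE ?addr_ge0 ?mulr_ge0 ?(ltW X0) // lerDl ltW.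
move=> x y ox oy hx hy [e].
have xs : x \in s by apply/sP.
have ys : y \in s by apply/sP.
by rewrite -(nth_index 0 xs) e nth_index.
Qed.

(** * Cones and the local height functions *)

(* [Num.Theory] also exports a [realN]. *)
Local Notation realN := Defs.realN.

Lemma exists_pos_lower_bound (R : realType) (I : finType) (P : I -> Prop) (f : I -> R) :
  (forall i, P i -> 0 < f i) -> exists2 e, 0 < e & forall i, P i -> e <= f i.
Proof.
move=> hf; have [T T0 hT] := @exists_nat_bound R I (fun i => (f i)^-1).
exists T%:R^-1; first by rewrite invr_gt0 ltr0n.
by move=> i /hf fi; rewrite -[f i]invrK lef_pV2 ?posrE ?ltr0n ?invr_gt0.
Qed.

Section Cones.
Variables (R : realType) (d l r : nat) (n : 'I_l -> nat).
Variables (Sigma : {set {set 'I_r}}) (b : 'I_r -> 'I_d -> int).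
Hypothesis hn : forall i, (0 < n i)%N.
Hypothesis hfan : complete_simplicial_fan R Sigma b.
Variables (tr : 'I_r -> R) (tY : Ntype d l -> R).
Hypothesis ht : Lambda_interior n Sigma b tr tY.

(** The fan gives independence over Q only; row-freeness of a rational matrix survives extension of
    the field to R. *)
Lemma cone_independent (S : {set 'I_r}) (a : 'I_r -> R) : S \in Sigma ->
  (forall rho, rho \notin S -> a rho = 0) ->
  (forall j, \sum_rho a rho * (b rho j)%:~R = 0) -> forall rho, a rho = 0.
Proof.
move=> hS aS a0; case: hfan => _ [_ [_ [indep _]]].
(* The last r columns encode the support condition a rho = 0 off S. *)
pose M : 'M[rat]_(r, d + r) := row_mx (\matrix_(i, j) (b i j)%:~R)
  (diag_mx (\row_i (i \notin S)%:R)).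
have Mfree : row_free M.
  apply: inj_row_free => v; rewrite mul_mx_row -[0]row_mx0 => /eq_row_mx[e1 e2].
  apply/rowP => i; rewrite mxE; apply: (indep S hS (fun i => v 0 i)) => [k kS|j].
    by move/rowP: e2 => /(_ k); rewrite mul_mx_diag !mxE kS mulr1.
  move/rowP: e1 => /(_ j); rewrite !mxE; apply: etrans.
  by apply: eq_bigr => k _; rewrite mxE.
have : row_free (map_mx (ratr : rat -> R) M) by rewrite row_free_map.
move=> /row_free_inj inj rho.
suff : \row_i a i = 0 by move/rowP => /(_ rho); rewrite !mxE.
apply: inj; rewrite mul0mx map_row_mx mul_mx_row -[RHS]row_mx0; congr row_mx.
  apply/rowP => j; rewrite !mxE; apply: etrans (a0 j).
  by apply: eq_bigr => k _; rewrite !mxE ratr_int.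
apply/rowP => k; rewrite map_diag_mx mul_mx_diag !mxE.
by have [kS|/aS ->] := boolP (k \in S); rewrite ?mul0r ?rmorph0 ?mulr0.
Qed.

(** y lies in the common face S :&: S'. Its coordinates there agree with a by independence in S, and
    with a' by independence in S'. *)
Lemma cone_coord_uniq S S' (y : 'I_d -> R) (a a' : 'I_r -> R) : S \in Sigma -> S' \in Sigma ->
  cone_coord b S y a -> cone_coord b S' y a' -> a = a'.
Proof.
move=> hS hS' ca ca'.
have [c [cS [c0 cy]]] : in_cone b (S :&: S') y.
  case: hfan => _ [_ [_ [_ [inter _]]]].
  by apply: inter => //; [exists a|exists a'].
have key T (u : 'I_r -> R) : T \in Sigma -> S :&: S' \subset T ->
    cone_coord b T y u -> forall rho, u rho = c rho.
  move=> hT sT [uT [_ uy]] rho; apply/eqP; rewrite -subr_eq0; apply/eqP.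
  apply: (@cone_independent T (fun k => u k - c k)) => // [k kT|j].
    by rewrite uT // cS ?subrr //; apply: contra kT; exact: (fintype.subsetP sT).
  rewrite (eq_bigr (fun k => u k * (b k j)%:~R - c k * (b k j)%:~R)) => [|k _].
    by rewrite sumrB -uy -cy subrr.
  by rewrite mulrBl.
apply/funext => rho.
by rewrite (key S a) ?subsetIl // (key S' a') ?subsetIr.
Qed.

Lemma acoordP (y : 'I_d -> R) :
  exists2 S, S \in Sigma & cone_coord b S y (acoord Sigma b y).
Proof.
rewrite /acoord; case: xgetP => [a _ //|h].
case: hfan => _ [_ [_ [_ [_ cover]]]].
by have [S hS [a ca]] := cover y; case: (h a); exists S.
Qed.

Lemma acoord_uniq (S : {set 'I_r}) (y : 'I_d -> R) a :
  S \in Sigma -> cone_coord b S y a -> acoord Sigma b y = a.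
Proof. by move=> hS ca; have [S' hS' ca'] := acoordP y; exact: cone_coord_uniq ca' ca. Qed.

Lemma acoord_ge0 (y : 'I_d -> R) rho : 0 <= acoord Sigma b y rho.
Proof. by have [S _ [_ []]] := acoordP y. Qed.

Lemma acoordE (y : 'I_d -> R) j : y j = \sum_rho acoord Sigma b y rho * (b rho j)%:~R.
Proof. by have [S _ [_ []]] := acoordP y. Qed.

Lemma acoord_zero (y : 'I_d -> R) : (forall j, y j = 0) ->
  acoord Sigma b y = fun=> 0.
Proof.
move=> y0; have e0 : finset.set0 \in Sigma by case: hfan.
apply: (acoord_uniq e0); split=> //; split=> // j.
by rewrite y0 big1 // => rho _; rewrite mul0r.
Qed.

(** Fractional parts vanish off the cone of x, so they are coordinates of q(x) in that same cone. *)
Lemma acoord_qmap x : acoord Sigma b (realN R (qmap R n Sigma b x)) =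
  fun rho => acoord Sigma b (realN R x) rho -
    (Num.floor (acoord Sigma b (realN R x) rho))%:~R.
Proof.
set a := acoord Sigma b (realN R x).
have [S hS [aS [a0 ay]]] := acoordP (realN R x); rewrite -/a in aS a0 ay.
apply: (acoord_uniq hS); split; [|split].
- by move=> rho /aS ->; rewrite floor0 subrr.
- by move=> rho; rewrite subr_ge0 floor_le.
move=> j; rewrite /realN /qmap /= ffunE -/a intrB rmorph_sum /=.
have -> : (x.1 j)%:~R = realN R x j by [].
rewrite ay -sumrB; apply: eq_bigr => rho _.
by rewrite intrM mulrBl.
Qed.

Lemma acoord_bound : exists2 K : nat, (0 < K)%N & forall (y : 'I_d -> R) j,
  `|y j| <= K%:R * \sum_rho acoord Sigma b y rho.
Proof.
have [K K0 hK] := @exists_nat_bound R ('I_r * 'I_d)%type (fun p => `|(b p.1 p.2)%:~R|).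
exists K => // y j; rewrite [y j]acoordE (le_trans (ler_norm_sum _ _ _)) // mulr_sumr.
apply: ler_sum => rho _; rewrite normrM ger0_norm ?acoord_ge0 // mulrC.
by rewrite ler_wpM2r ?acoord_ge0 //; exact: (hK (rho, j)).
Qed.

(** There are finitely many twisted sectors: their cone coordinates are fractional parts, so their
    lattice coordinates are at most K r, and their torsion coordinates are reduced. [dec]
    parametrizes a finite box containing them all. *)
Lemma twisted_lower_bound : exists2 e : R, 0 < e & forall Y, twisted R n Sigma b Y ->
  e <= tY Y + \sum_rho acoord Sigma b (realN R Y) rho * tr rho.
Proof.
have [K K0 hK] := acoord_bound.
pose m := (K * r)%N; pose N := (\max_i n i).+1.
pose dec (p : {ffun 'I_d -> 'I_(2 * m).+1} * {ffun 'I_l -> 'I_N}) : Ntype d l :=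
  ([ffun j => (p.1 j : int) - (m : int)], [ffun i => (p.2 i : int)]).
have [e e0 he] := @exists_pos_lower_bound R _ (fun p => twisted R n Sigma b (dec p))
  (fun p => tY (dec p) + \sum_rho acoord Sigma b (realN R (dec p)) rho * tr rho)
  (fun p => ht.2 (dec p)).
exists e => // Y hY.
suff [p ep] : exists p, Y = dec p by rewrite ep; apply: he; rewrite -ep.
have [[x _ xY] _] := hY.
have bj j : `|Y.1 j| <= m.
  rewrite -(ler_int R) intr_norm -/(realN R Y j) (le_trans (hK _ _)) //.
  rewrite /m -pmulrn natrM ler_wpM2l // -xY acoord_qmap.
  apply: (@le_trans _ _ (\sum_(rho < r) 1)); last by rewrite sumr_const card_ord.
  apply: ler_sum => rho _; set a := acoord _ _ _ _.
  by have := floorD1_gt a; rewrite intrD lerBlDl addrC => /ltW; rewrite addrC.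
have bi i : 0 <= Y.2 i < N.
  rewrite -xY /= ffunE modz_ge0 ?ltz_pmod //=; last by have := hn i; lia.
  have h1 : ((x.2 i %% n i)%Z < n i)%R by rewrite ltz_pmod //; exact: hn.
  by apply: lt_trans h1 _; rewrite ltz_nat ltnS leq_bigmax.
have oj j : (absz (Y.1 j + m%:Z)%R < (2 * m).+1)%N by have := bj j; lia.
have oi i : (`|Y.2 i| < N)%N by have := bi i; lia.
exists ([ffun j => Ordinal (oj j)], [ffun i => Ordinal (oi i)]).
rewrite [LHS]surjective_pairing /dec; congr pair; apply/ffunP => k; rewrite !ffunE /=.
  by have := bj k; lia.
by have := bi k; lia.
Qed.

Lemma phiN_bounds : exists2 c : nat, (0 < c)%N & forall x, nred n x = x ->
  [/\ 0 <= phiN n Sigma b tr tY x,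
    x != N0 d l -> 1 <= c%:R * phiN n Sigma b tr tY x &
    forall j, `|x.1 j|%:~R <= c%:R * phiN n Sigma b tr tY x].
Proof.
have [e1 e10 h1] := twisted_lower_bound.
have [e2 e20 h2] := @exists_pos_lower_bound R _ (fun=> True) tr (fun i _ => ht.1 i).
have [K K0 hK] := acoord_bound.
pose e := Num.min e1 e2.
have e0 : 0 < e by rewrite lt_min e10.
have [c c0 hc] := @exists_nat_bound R bool
  (fun t => if t then e^-1 else K%:R * (r.+1)%:R / e).
have c1 : 1 <= c%:R * e by have := hc true; rewrite -[e^-1]mul1r ler_pdivrMr.
have c2 : K%:R * (r.+1)%:R <= c%:R * e by have := hc false; rewrite ler_pdivrMr.
exists c => // x xn.
set a := acoord Sigma b (realN R x).
set q := qmap R n Sigma b x.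
have aq := acoord_qmap x; rewrite -/a -/q in aq.
have a0 rho : 0 <= a rho by exact: acoord_ge0.
have fa rho : 0 <= (Num.floor (a rho))%:~R :> R by rewrite ler0z floor_ge0.
set s : R := \sum_rho (Num.floor (a rho))%:~R.
have s0 : 0 <= s by exact: sumr_ge0.
pose t : R := (q != N0 d l)%:R.
have t0 : 0 <= t by [].
have phi_ge : e * (t + s) <= phiN n Sigma b tr tY x.
  have es : e * s <= \sum_rho (Num.floor (a rho))%:~R * tr rho.
    rewrite mulr_sumr; apply: ler_sum => rho _; rewrite mulrC ler_wpM2l //.
    by rewrite (le_trans _ (h2 rho I)) // /e ge_min lexx orbT.
  have sumE : \sum_rho a rho * tr rho =
      \sum_rho acoord Sigma b (realN R q) rho * tr rho +
      \sum_rho (Num.floor (a rho))%:~R * tr rho.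
    rewrite -big_split /=; apply: eq_bigr => rho _.
    by rewrite aq -mulrDl subrK.
  rewrite /phiN -/q -/a sumE mulrDr /t; case: ifPn => hq.
    rewrite mulr1 addrA lerD // (le_trans _ (h1 q _)) //.
      by rewrite /e ge_min lexx.
    by split; [exists x|apply/eqP].
  rewrite mulr0 !add0r (le_trans es) // lerDr sumr_ge0 // => rho _.
  by rewrite mulr_ge0 ?acoord_ge0 // ltW // (ht.1 rho).
have a_small : \sum_rho a rho <= r.+1%:R * (t + s).
  have [q0|q0] := eqVneq q (N0 d l).
    have az : \sum_rho a rho = s.
      apply: eq_bigr => rho _; apply/eqP; rewrite -subr_eq0.
      have := congr1 (fun f => f rho) aq; rewrite /= q0 acoord_zero => [<- //|j].
      by rewrite /realN /= ffunE.
    rewrite az (le_trans (_ : s <= t + s)) ?lerDr //.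
    by rewrite ler_peMl ?addr_ge0 // ler1n.
  have t1 : t = 1 by rewrite /t q0.
  apply: (@le_trans _ _ (\sum_rho ((Num.floor (a rho))%:~R + 1))).
    by apply: ler_sum => rho _; have := floorD1_gt (a rho); rewrite intrD => /ltW.
  rewrite big_split /= sumr_const card_ord -/s t1 mulrDr mulr1 addrC lerD //.
    by rewrite ler_nat.
  by rewrite ler_peMl // ler1n.
have ts_bound u : u <= t + s -> 0 <= u -> u <= c%:R * phiN n Sigma b tr tY x.
  move=> hu u0; apply: (@le_trans _ _ (c%:R * (e * (t + s)))).
    rewrite mulrA (le_trans hu) // ler_peMl ?addr_ge0 //.
  by rewrite ler_wpM2l.
split.
- by apply: le_trans phi_ge; rewrite mulr_ge0 ?addr_ge0 // ltW.
- move=> x0; apply: ts_bound => //.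
  have [q0|q0] := eqVneq q (N0 d l); last by rewrite /t q0 lerDl.
  have [[rho rho1]|none] := pselect (exists rho, 1 <= Num.floor (a rho)).
    rewrite (le_trans (_ : 1 <= s)) ?lerDr // /s (bigD1 rho) //=.
    rewrite (le_trans (_ : 1 <= (Num.floor (a rho))%:~R)) ?ler1z // lerDl.
    by rewrite sumr_ge0.
  exfalso; move/eqP: x0; apply.
  have fl0 rho : Num.floor (a rho) = 0.
    apply/eqP; rewrite eq_le floor_ge0 a0 andbT -ltzD1 add0r ltNge.
    by apply/negP => h; apply: none; exists rho.
  (* With all integral parts 0, q(x) is [nred n x]; here x has to be reduced. *)
  have : q = x; last by move=> <-.
  rewrite -[RHS]xn /q /qmap -/a; congr nred.
  rewrite [RHS]surjective_pairing; congr pair; apply/ffunP => j; rewrite ffunE.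
  by rewrite big1 ?subr0 // => rho _; rewrite fl0 mul0r.
move=> j; rewrite intr_norm -/(realN R x j) (le_trans (hK _ _)) // -/a.
apply: (@le_trans _ _ (K%:R * (r.+1%:R * (t + s)))); first by rewrite ler_wpM2l.
apply: (@le_trans _ _ (c%:R * (e * (t + s)))); last by rewrite ler_wpM2l.
by rewrite !mulrA ler_wpM2r ?addr_ge0.
Qed.

(** Makes the local factor 1 at every place where all coordinates of the point are units. *)
Lemma phiN_N0 : phiN n Sigma b tr tY (N0 d l) = 0.
Proof.
have az : acoord Sigma b (realN R (N0 d l)) = fun=> 0.
  by apply: acoord_zero => j; rewrite /realN /= ffunE.
have q0 : qmap R n Sigma b (N0 d l) = N0 d l.
  rewrite /qmap az /nred /N0 /=; congr pair; apply/ffunP => k; rewrite !ffunE ?mod0z //.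
  by rewrite big1 ?subr0 // => rho _; rewrite floor0 mul0r.
by rewrite /phiN q0 eqxx /= add0r big1 // => rho _; rewrite az mul0r.
Qed.

Lemma phiInf_bounds : exists2 c : nat, (0 < c)%N & forall y : 'I_d -> R,
  0 <= phiInf Sigma b tr y /\ forall j, `|y j| <= c%:R * phiInf Sigma b tr y.
Proof.
have [e2 e20 h2] := @exists_pos_lower_bound R _ (fun=> True) tr (fun i _ => ht.1 i).
have [K K0 hK] := acoord_bound.
have [c c0 hc] := @exists_nat_bound R unit (fun=> K%:R / e2).
exists c => // y; have phi_ge : e2 * \sum_rho acoord Sigma b y rho <= phiInf Sigma b tr y.
  rewrite mulr_sumr; apply: ler_sum => rho _.
  by rewrite mulrC ler_wpM2l ?acoord_ge0 //; exact: h2.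
have s0 : 0 <= \sum_rho acoord Sigma b y rho.
  by apply: sumr_ge0 => rho _; exact: acoord_ge0.
split; first by apply: le_trans phi_ge; rewrite mulr_ge0 // ltW.
move=> j; rewrite (le_trans (hK _ _)) //.
apply: (@le_trans _ _ (c%:R * (e2 * \sum_rho acoord Sigma b y rho))).
  by rewrite mulrA ler_wpM2r // -ler_pdivrMr //; exact: (hc tt).
by rewrite ler_wpM2l.
Qed.

End Cones.

(** * Heights *)

Lemma prod_ge1_subset (R : realType) (T : eqType) (s t : seq T) (f : T -> R) : uniq t ->
  {subset t <= s} -> (forall x, x \in s -> 1 <= f x) ->
  \prod_(x <- t) f x <= \prod_(x <- s) f x.
Proof.
elim: t s => [|x t IH] s.
  move=> _ _ f1; rewrite big_nil; elim: s f1 => [|y s IHs] f1; first by rewrite big_nil.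
  rewrite big_cons mulr_ege1 ?f1 ?mem_head // IHs // => z zs.
  by apply: f1; rewrite inE zs orbT.
rewrite cons_uniq => /andP[xt ut] ts f1; have xs : x \in s by apply: ts; rewrite mem_head.
have x0 : 0 < f x by rewrite (lt_le_trans ltr01) // f1.
rewrite big_cons (big_rem x xs) /= ler_pM2l //.
apply: IH => // [y yt|y yr]; last by apply: f1; exact: mem_rem yr.
have ys : y \in s by apply: ts; rewrite inE yt orbT.
have := perm_to_rem xs => /perm_mem/(_ y); rewrite ys inE => /esym/orP[/eqP e|//].
by move: xt; rewrite -e yt.
Qed.

(** The list s witnesses that the support is finite, without which the product would be 1 by
    convention; then omitting factors that are at least 1 only decreases it. *)
Lemma fsbig_prod_ge (R : realType) (T : choiceType) (A : set T) (f : T -> R)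
  (s t : seq T) : (forall x, A x -> 1 <= f x) ->
  (forall x, A x -> x \notin s -> f x = 1) ->
  uniq t -> (forall x, x \in t -> A x) ->
  \prod_(x <- t) f x <= \big[*%R/1]_(x \in A) f x.
Proof.
move=> f1 fs ut tA.
pose r := undup ([seq x <- s | x \in A] ++ t).
have rA x : x \in r -> A x.
  by rewrite mem_undup mem_cat mem_filter => /orP[/andP[/set_mem]|/tA].
rewrite (@fsbigE _ _ _ _ A r f) ?undup_uniq //; last first.
  move=> x Ax xr; apply: fs => //; apply: contra xr => xs.
  by rewrite mem_undup mem_cat mem_filter xs (mem_set Ax).
rewrite [leRHS]big_seq_cond (eq_bigl (fun x => x \in r)); last first.
  by move=> x; case: (boolP (x \in r)) => //= /rA /mem_set ->.
rewrite -big_seq; apply: prod_ge1_subset => // [x xt|x /rA/f1 //].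
by rewrite mem_undup mem_cat xt orbT.
Qed.

Section Heights.
Variables (R : realType) (F : fieldExtType rat) (d l r : nat) (n : 'I_l -> nat).
Variables (b : 'I_r -> 'I_d -> int) (Sigma : {set {set 'I_r}}).
Hypothesis hn : forall i, (0 < n i)%N.
Hypothesis hfan : complete_simplicial_fan R Sigma b.
Variables (tr : 'I_r -> R) (tY : Ntype d l -> R).
Hypothesis ht : Lambda_interior n Sigma b tr tY.
Variables (D : nat) (sigma : 'I_D -> {rmorphism F -> R[i]}) (om : 'I_D -> F).
Hypothesis hframe : integral_frame sigma om.
Implicit Types (x : tpoint F d l) (w : F -> int).

Let phi w x := phiN n Sigma b tr tY (log_fin n w x).
Let ffin x w : R := (qv w)%:R `^ phi w x.
Let finf x v : R := expR (locdeg v * phiInf Sigma b tr (log_inf v x)).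

Let nred_log w x : nred n (log_fin n w x) = log_fin n w x.
Proof.
rewrite /nred /log_fin /=; congr pair.
by apply/ffunP => i; rewrite !ffunE modz_mod.
Qed.

Let q1 w : is_ord w -> 1 <= (qv w)%:R :> R.
Proof. by move=> hw; rewrite ler1n ltnW // (qv_gt1 hframe hw). Qed.

Let ffin_ge1 x w : is_ord w -> 1 <= ffin x w.
Proof.
move=> hw; have [c c0 hc] := phiN_bounds hn hfan ht.
have [h0 _ _] := hc _ (nred_log w x).
by rewrite -[leLHS](@powRr0 _ (qv w)%:R) ler_powR // q1.
Qed.

Lemma fin_part_ge x (t : seq (F -> int)) : valid_point x -> uniq t ->
  (forall w, w \in t -> is_ord w) ->
  \prod_(w <- t) ffin x w <= \big[*%R/1]_(w \in @fin_places F) ffin x w.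
Proof.
move=> [x1 x2] ut ht'.
have [s1 hs1] := choice (fun j => support_finite hframe (x1 j)).
have [s2 hs2] := choice (fun i => support_finite hframe (x2 i)).
apply: (@fsbig_prod_ge _ _ _ _ (flatten [seq s1 j | j <- enum 'I_d] ++
    flatten [seq s2 i | i <- enum 'I_l])) => //; first by move=> w; exact: ffin_ge1.
move=> w hw; rewrite mem_cat negb_or => /andP[h1 h2].
suff e : log_fin n w x = N0 d l by rewrite /ffin /phi e phiN_N0 ?powRr0.
have e1 j : w (x.1 j) = 0.
  apply/eqP; apply: contraNT h1 => wj; apply/flattenP; exists (s1 j).
    by apply: map_f; rewrite mem_enum.
  by apply/(hs1 j).2.
have e2 i : w (x.2 i) = 0.
  apply/eqP; apply: contraNT h2 => wi; apply/flattenP; exists (s2 i).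
    by apply: map_f; rewrite mem_enum.
  by apply/(hs2 i).2.
rewrite /log_fin /nred /N0 /=; congr pair; apply/ffunP => k; rewrite !ffunE ?e1 //.
by rewrite e2 mod0z.
Qed.

Let place i : set (F -> R[i]) :=
  [set (sigma i : F -> R[i]); fun y => conjc (sigma i y)]%classic.

Let place_inf i : inf_places (place i).
Proof. by exists (sigma i) => //; exact: rmorphism_is_emb. Qed.

Let absv_place i y : absv (place i) y = normc (sigma i y).
Proof.
rewrite /absv; case: xgetP => [s _ [->|->]|h]; rewrite ?normc_conjc //.
by case: (h (sigma i)); left.
Qed.

Let finf_ge1 x v : 1 <= finf x v.
Proof.
have [c c0 hc] := phiInf_bounds hfan ht; have [h0 _] := hc (log_inf v x).
by rewrite /finf -expR0 ler_expR mulr_ge0 // /locdeg; case: ifP.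
Qed.

Lemma inf_part_ge x (t : seq (set (F -> R[i]))) : uniq t ->
  (forall v, v \in t -> inf_places v) ->
  \prod_(v <- t) finf x v <= \big[*%R/1]_(v \in @inf_places F R) finf x v.
Proof.
move=> ut ht'.
apply: (@fsbig_prod_ge _ _ _ _ [seq place i | i <- enum 'I_D]) => //.
move=> v [s es ->] /negP[]; have [_ surj _ _ _] := hframe.
have [i ->] := surj _ es; apply/mapP; exists i => //; by rewrite mem_enum.
Qed.

Lemma height_bounds x B : valid_point x -> height n Sigma b tr tY x <= B ->
  [/\ 1 <= B,
    (forall t : seq (F -> int), uniq t -> (forall w, w \in t -> is_ord w) ->
      \prod_(w <- t) ffin x w <= B) &
    forall i, expR (phiInf Sigma b tr (log_inf (place i) x)) <= B].
Proof.
move=> vx; rewrite /height.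
set H1 := \big[*%R/1]_(w \in _) _; set H2 := \big[*%R/1]_(v \in _) _ => hB.
have f1 t := @fin_part_ge x t vx; have f2 t := @inf_part_ge x t.
have H1_ge1 : 1 <= H1 by have := f1 [::] isT; rewrite big_nil; apply.
have H2_ge1 : 1 <= H2 by have := f2 [::] isT; rewrite big_nil; apply.
have B1 : H1 <= B by apply: le_trans hB; rewrite ler_peMr // (le_trans ler01).
have B2 : H2 <= B by apply: le_trans hB; rewrite ler_peMl // (le_trans ler01).
split; first exact: le_trans B1.
  by move=> t ut ht'; apply: le_trans B1; exact: f1.
move=> i; apply: le_trans B2.
have := f2 [:: place i] isT; rewrite big_cons big_nil mulr1 => h.
apply: le_trans (h _); last by move=> v; rewrite inE => /eqP ->; exact: place_inf.
rewrite ler_expR; have [c c0 hc] := phiInf_bounds hfan ht.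
have [h0 _] := hc (log_inf (place i) x).
by rewrite ler_peMl // /locdeg; case: ifP => // _; rewrite ler1n.
Qed.

Lemma rigid_bound : exists2 c : nat, (0 < c)%N & forall x B, valid_point x ->
  height n Sigma b tr tY x <= B -> forall j, exists m : nat,
  [/\ (0 < m)%N, m%:R <= B ^+ c, inO (m%:R * x.1 j) &
    forall i, normc (sigma i (m%:R * x.1 j)) <= B ^+ c].
Proof.
have [c1 c10 hc1] := phiN_bounds hn hfan ht.
have [c2 c20 hc2] := phiInf_bounds hfan ht.
exists (c1 + c2)%N; first by rewrite addn_gt0 c10.
move=> x B vx hB j; have [B1 hfin hinf] := height_bounds vx hB.
have ex w : exists p : nat, is_ord w -> [/\ (1 < p)%N, (p <= qv w)%N & vge w 1 p%:R].
  have [/(small_prime_element hframe)[p hp]|hw] := pselect (is_ord w); first by exists p.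
  by exists 0%N.
have [p hp] := choice ex.
have xj0 : x.1 j != 0 by case: vx.
have [s [us sP]] := support_finite hframe xj0.
have sord w : w \in s -> is_ord w by case/sP.
(* A rational integer divisible enough at every pole of x.1 j, and at most the product of the
   q_w^|w(x.1 j)| because p w <= q_w. *)
pose m := (\prod_(w <- s) p w ^ `|w (x.1 j)|)%N.
have m0 : (0 < m)%N.
  rewrite /m big_seq prodn_cond_gt0 // => w ws; rewrite expn_gt0.
  by have [p1 _ _] := hp w (sord w ws); rewrite (ltnW p1).
have mB : m%:R <= B ^+ c1.
  apply: (@le_trans _ _ ((\prod_(w <- s) ffin x w) ^+ c1)); last first.
    rewrite lerXn2r ?nnegrE ?(le_trans ler01 B1) ?hfin //.
    by rewrite prodr_ge0 // => w _; exact: powR_ge0.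
  rewrite /m natr_prod -prodrXl big_seq [leRHS]big_seq; apply: ler_prod => w ws.
  rewrite ler0n /=; have hw := sord w ws; have [p1 pq _] := hp w hw.
  apply: (@le_trans _ _ ((qv w)%:R ^+ `|w (x.1 j)|)).
    by rewrite natrX lerXn2r ?nnegrE // ler_nat.
  have [_ _ /(_ j)] := hc1 _ (nred_log w x).
  rewrite /log_fin /= ffunE => h.
  rewrite -powR_mulrn // /ffin -powR_mulrn ?powR_ge0 // -powRrM.
  apply: ler_powR; first exact: q1.
  by rewrite mulrC [leLHS]pmulrn abszE.
have c1c : B ^+ c1 <= B ^+ (c1 + c2) by rewrite ler_weXn2l // leq_addr.
exists m; split=> //; first exact: le_trans c1c.
  move=> w hw; have mF : m%:R != 0 :> F by rewrite natF_eq0 -lt0n.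
  have [ws|ws] := boolP (w \in s); last first.
    have w0 : w (x.1 j) = 0.
      by apply/eqP; apply: contraNT ws => h; apply/sP.
    by rewrite vgeM0 ?vge_nat // vgeE // w0.
  have pF v : v \in s -> (p v)%:R != 0 :> F.
    by move=> /sord /hp[p1 _ _]; rewrite natF_eq0 -lt0n ltnW.
  rewrite vgeE ?mulf_neq0 // ordM //.
  have wm : `|w (x.1 j)|%N%:Z <= w m%:R.
    rewrite /m (big_rem w ws) /= natrM natrX.
    have [p1 _ vp] := hp w hw; have p0 := pF w ws.
    have P0 : (\prod_(y <- rem w s) p y ^ `|y (x.1 j)|)%N%:R != 0 :> F.
      rewrite natF_eq0 -lt0n big_seq prodn_cond_gt0 // => v /mem_rem vs.
      by rewrite expn_gt0; have [p1' _ _] := hp v (sord v vs); rewrite (ltnW p1').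
    rewrite ordM ?expf_neq0 // ordX //.
    have h1 : 0 <= w (\prod_(y <- rem w s) p y ^ `|y (x.1 j)|)%N%:R.
      by rewrite -vge_is_ord0 // vge_nat.
    have h2 : 1 <= w (p w)%:R by move: vp; rewrite vgeE.
    rewrite (le_trans (_ : _ <= w (p w)%:R * `|w (x.1 j)|%N%:Z)) ?lerDl //.
    by rewrite ler_peMl.
  lia.
move=> i; rewrite rmorphM ComplexField.Normc.normcM rmorph_nat exprD.
apply: ler_pM; rewrite ?normc_ge0 //.
  by rewrite -[m%:R]/((m : int)%:~R) normc_int -pmulrn normr_nat.
have [_ /(_ j)] := hc2 (log_inf (place i) x).
rewrite /log_inf normrN absv_place => h.
have n0 : 0 < normc (sigma i (x.1 j)) by rewrite normc_gt0 // fmorph_eq0.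
rewrite -(lnK n0).
apply: (@le_trans _ _ (expR (phiInf Sigma b tr (log_inf (place i) x)) ^+ c2)).
  by rewrite -expRM_natl ler_expR (le_trans (ler_norm _)).
by rewrite lerXn2r ?nnegrE ?expR_ge0 ?(le_trans ler01 B1).
Qed.

(** Where n_i does not divide w(u_i) the logarithm is nonzero, so phi >= 1/c1 and q_w is at most the
    c1-th power of the local factor. Hence the product of q_w in [bounded_representative] is at most
    B^c1. *)
Lemma torsion_bound : exists (c : nat) (C : R), 1 <= C /\ forall x B, valid_point x ->
  height n Sigma b tr tY x <= B -> forall i, exists e : F,
  [/\ e != 0, inO (x.2 i * e ^+ n i) &
    forall k, normc (sigma k (x.2 i * e ^+ n i)) <= (C * B ^+ c) ^+ n i].
Proof.
have [c1 c10 hc1] := phiN_bounds hn hfan ht.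
have [C C1 hC] := bounded_representative hframe.
exists c1, C; split=> // x B vx hB i; have [B1 hfin _] := height_bounds vx hB.
have xi0 : x.2 i != 0 by case: vx.
have [s0 [us0 s0P]] := support_finite hframe xi0.
pose s := [seq w <- s0 | ~~ (n i %| w (x.2 i))%Z].
have us : uniq s by rewrite filter_uniq.
have sord w : w \in s -> is_ord w by rewrite mem_filter => /andP[_ /s0P[]].
have [|e [e0 oe he]] := hC (n i) (x.2 i) s (hn i) xi0 us sord.
  move=> w hw nd; rewrite mem_filter nd; apply/s0P; split=> //.
  by apply: contraNneq nd => ->; exact: dvdz0.
exists e; split=> // k; apply: le_trans (he k) _.
have C0 : 0 <= C by rewrite (le_trans ler01).
have B0 : 0 <= B by rewrite (le_trans ler01).
rewrite lerXn2r ?nnegrE ?mulr_ge0 ?exprn_ge0 // ler_wpM2l //.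
apply: (@le_trans _ _ ((\prod_(w <- s) ffin x w) ^+ c1)); last first.
  rewrite lerXn2r ?nnegrE ?hfin //.
  by rewrite prodr_ge0 // => w _; exact: powR_ge0.
rewrite natr_prod -prodrXl big_seq [leRHS]big_seq; apply: ler_prod => w ws.
rewrite ler0n /=; have hw := sord w ws.
have [_ h _] := hc1 _ (nred_log w x).
have {}h := h _; rewrite /ffin -powR_mulrn ?powR_ge0 // -powRrM.
rewrite -[leLHS]powRr1 ?ler0n //; apply: ler_powR; first exact: q1.
rewrite mulrC; apply: h; apply/eqP => /(congr1 (fun z : Ntype d l => z.2 i)).
rewrite /log_fin /N0 /= !ffunE => /dvdz_mod0P nd.
by move: ws; rewrite mem_filter nd.
Qed.

End Heights.

(** * The final count *)

Theorem mainTheorem3 (R : realType) (F : fieldExtType rat)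
  (d l r : nat) (n : 'I_l -> nat)
  (b : 'I_r -> 'I_d -> int) (g : 'I_r -> 'I_l -> int)
  (Sigma : {set {set 'I_r}})
  (hn : forall i, (0 < n i)%N)
  (hfan : complete_simplicial_fan R Sigma b)
  (hbeta : finite_coker n b g)
  (tr : 'I_r -> R) (tY : Ntype d l -> R)
  (ht : Lambda_interior n Sigma b tr tY) :
  exists P : {poly R}, forall B : R, 0 <= B ->
    forall (k : nat) (pts : 'I_k -> tpoint F d l),
      (forall a, valid_point (pts a)) ->
      (forall a a', point_equiv n (pts a) (pts a') -> a = a') ->
      (forall a, height n Sigma b tr tY (pts a) <= B) ->
      k%:R <= P.[B].
Proof.
have [D [sigma [om hframe]]] := integral_frame_exists F R.
have [c1 c10 hrig] := rigid_bound hn hfan ht hframe.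
have [c2 [C [C1 htor]]] := torsion_bound hn hfan ht hframe.
(* [nm] is positive and at least every n_i, so that C^nm B^e dominates both B^c1 and all the (C
   B^c2)^(n_i). *)
pose nm := (\max_i n i).+1.
pose e := ((c1 + c2) * nm)%N.
pose C' := C ^+ nm.
(* K B^E bounds the number of codes: for a rigid coordinate 2 B^c1 denominators times (11 X)^D
   numerators, for a torsion coordinate (11 X)^D representatives. *)
pose K := ((2 * (11 * C') ^+ D) ^+ d) * ((11 * C') ^+ D) ^+ l.
pose E := ((c1 + e * D) * d + (e * D) * l)%N.
have C0 : 0 < C by rewrite (lt_le_trans ltr01).
have C'0 : 0 <= C' by rewrite exprn_ge0 // ltW.
have Y0 : 0 <= (11 * C') ^+ D by rewrite exprn_ge0 // mulr_ge0.
have K0 : 0 <= K by rewrite mulr_ge0 ?exprn_ge0 // mulr_ge0.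
exists (K *: 'X^E) => B B0 k pts vpts inj hB.
rewrite hornerZ hornerXn.
(* B >= 1 is known only from the height of an actual point, so the empty family is treated apart. *)
have [k0|[a0 _]] : k = 0%N \/ exists a : 'I_k, True.
  by case: k pts {vpts inj hB} => [|k] _; [left|right; exists ord0].
- by rewrite k0 mulr_ge0 ?exprn_ge0.
have [B1 _ _] := height_bounds hn hfan ht hframe (vpts a0) (hB a0).
pose X := C' * B ^+ e.
have nm0 : (0 < nm)%N by [].
have C'1 : 1 <= C' by rewrite exprn_ege1.
have Be1 m : 1 <= B ^+ m by rewrite exprn_ege1.
have X1 : 1 <= X by rewrite mulr_ege1.
have X0 : 0 < X by rewrite (lt_le_trans ltr01).
have [L [code [cL codeP]]] := integral_code hframe X1.
have ex1 a := choice (hrig (pts a) B (vpts a) (hB a)).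
have ex2 a := choice (htor (pts a) B (vpts a) (hB a)).
pose m a := projT1 (ex1 a).
have mP a j : [/\ (0 < m a j)%N, (m a j)%:R <= B ^+ c1, inO ((m a j)%:R * (pts a).1 j) &
    forall i, normc (sigma i ((m a j)%:R * (pts a).1 j)) <= B ^+ c1] := projT2 (ex1 a) j.
pose t a := projT1 (ex2 a).
have tP a i : [/\ t a i != 0, inO ((pts a).2 i * t a i ^+ n i) &
    forall j, normc (sigma j ((pts a).2 i * t a i ^+ n i)) <= (C * B ^+ c2) ^+ n i]
  := projT2 (ex2 a) i.
have rigX : B ^+ c1 <= X.
  rewrite -[leLHS]mul1r ler_pM ?exprn_ge0 // ler_weXn2l //.
  by rewrite /e (leq_trans (leq_addr c2 c1)) // leq_pmulr.
have torX i : (C * B ^+ c2) ^+ n i <= X.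
  have h1 : 1 <= C * B ^+ c2 by rewrite mulr_ege1.
  apply: (@le_trans _ _ ((C * B ^+ c2) ^+ nm)).
    by rewrite ler_weXn2l // /nm (leq_trans (leq_bigmax i)).
  rewrite exprMn ler_wpM2l ?(le_trans ler01 C'1) // -exprM ler_weXn2l //.
  by rewrite /e leq_mul2r leq_addl orbT.
pose M := Num.truncn (B ^+ c1).
have mM a j : (m a j < M.+1)%N.
  by have [_ h _ _] := mP a j; rewrite ltnS /M truncn_ge_nat ?exprn_ge0.
pose cd a : {ffun 'I_d -> 'I_M.+1 * L} * {ffun 'I_l -> L} :=
  ([ffun j => (Ordinal (mM a j), code ((m a j)%:R * (pts a).1 j))],
   [ffun i => code ((pts a).2 i * t a i ^+ n i)]).
have cdinj : injective cd.
  move=> a a' [/ffunP e1 /ffunP e2]; apply: inj; split=> [j|i].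
    have := e1 j; rewrite !ffunE => -[em ec].
    have [m0 _ o1 h1] := mP a j; have [_ _ o2 h2] := mP a' j.
    have mF : (m a j)%:R != 0 :> F by rewrite natF_eq0 -lt0n.
    apply: (mulfI mF); rewrite [in RHS]em; apply: codeP => // i.
      exact: le_trans (h1 i) rigX.
    exact: le_trans (h2 i) rigX.
  have := e2 i; rewrite !ffunE => ec.
  have [t0 o1 h1] := tP a i; have [t0' o2 h2] := tP a' i.
  have eq : (pts a).2 i * t a i ^+ n i = (pts a').2 i * t a' i ^+ n i.
    apply: codeP => // j; first exact: le_trans (h1 j) (torX i).
    exact: le_trans (h2 j) (torX i).
  (* From u t^n = u' t'^n one gets u' = u (t / t')^n. *)
  exists (t a i / t a' i); split; first by rewrite mulf_neq0 ?invr_eq0.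
  by rewrite exprMn exprVn mulrA eq mulfK // expf_neq0.
have := leq_card cd cdinj; rewrite card_ord -(ler_nat R) => /le_trans; apply.
rewrite card_prod !card_ffun !card_ord card_prod card_ord natrM !natrX natrM.
have MB : M.+1%:R <= 2 * B ^+ c1.
  rewrite -natr1 mulr2n mulrDl mul1r lerD // /M truncn_le exprn_ge0 //.
have MB0 : 0 <= 2 * B ^+ c1 by rewrite mulr_ge0 // exprn_ge0.
have X11 : 0 <= (11 * X) ^+ D by rewrite exprn_ge0 // mulr_ge0 // ltW.
apply: (@le_trans _ _ ((2 * B ^+ c1 * (11 * X) ^+ D) ^+ d * ((11 * X) ^+ D) ^+ l)).
  apply: ler_pM; rewrite ?exprn_ge0 ?mulr_ge0 //.
    apply: lerXn2r; rewrite ?nnegrE ?mulr_ge0 //; first exact: exprn_ge0.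
    exact: ler_pM.
  by rewrite lerXn2r ?nnegrE.
rewrite le_eqVlt; apply/orP; left; apply/eqP.
have -> : (11 * X) ^+ D = (11 * C') ^+ D * B ^+ (e * D).
  by rewrite /X mulrA exprMn exprM.
rewrite /K /E; move: (11 * C') (e * D)%N => Y k'.
by rewrite exprD !exprM exprD !exprMn; ring.
Qed.
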